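(* Assume that $\sigma(B)\subset[\delta,\infty)$ for some $\delta>0$. Then for every $X(0)\in\mathcal V$ the solution $X(t)\in C(\mathbb R,\mathcal V)$ to $\dot X(t)=AX(t)$, $t\in\mathbb R$, with initial value $X(0)$ admits the spectral representation $$X(t)=\Lambda^{-1}\int e^{-i\omega t}\,dE(\omega)\,\Lambda X(0),$$ where $E(\omega)$ is the spectral resolution of the selfadjoint operator $H$.
   Context: $\mathcal X$ is a complex Hilbert space; $B$ is a selfadjoint operator in $\mathcal X$ with dense domain $D(B)$; $J$ is a bounded linear operator in $\mathcal X$ with $J^*=-J$ and $J^2=-1$; $A=JB$. $\Lambda:=B^{1/2}$ is the positive square root, and $\mathcal V:=D(\Lambda)$ is the Hilbert space with the norm $\Vert X\Vert_{\mathcal V}=\Vert\Lambda X\Vert_{\mathcal X}$. Under the spectral assumption, $A^{-1}=-B^{-1}J:\mathcal X\to\mathcal V$ is bounded, and $H=\Lambda iJ\Lambda$ with domain $D(H)=\{X\in\mathcal V: J\Lambda X\in\mathcal V\}$ is a densely defined selfadjoint operator in $\mathcal X$; $E(\omega)$ denotes its spectral resolution, $HZ=\int\omega\,dE(\omega)Z$ for $Z\in D(H)$, with Riemann–Stieltjes integrals converging in $\mathcal X$. A solution to $\dot X=AX$ means a function $X(t)\in C(\mathbb R,\mathcal V)$ with $A^{-1}[X(t)-X(0)]=\int_0^tX(s)\,ds$ for all $t\in\mathbb R$ (such a solution exists and is unique for every $X(0)\in\mathcal V$). *)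

(* Defs.v *)
From mathcomp Require Import all_boot all_order all_algebra.
From mathcomp Require Import sesquilinear complex.
From mathcomp Require Import all_classical all_reals all_analysis.

Set Implicit Arguments.
Unset Strict Implicit.
Unset Printing Implicit Defensive.

Import Order.TTheory GRing.Theory Num.Theory Num.Def.
Import numFieldNormedType.Exports.
Local Open Scope classical_set_scope.
Local Open Scope complex_scope.
Local Open Scope ring_scope.

(* A complex Hilbert space is a complete normed space [X] over [R[i]] with an
   inner product [dot : {dot X for conjC}] (linear in the first argument,
   conjugate-linear in the second) such that [`|x| ^+ 2 = dot x x].
   Norms take values in [R[i]], whose order is [z <= w] iff [w - z] is real
   and nonnegative; real numbers are embedded by [%:C]. *)

Section Operators.
Variables (R : realType) (X : completeNormedModType R[i]).

(* A linear operator in [X] with domain [dom]; the values of [opfun] outside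
   of [dom] are irrelevant. *)
Record operator := Operator {
  dom : set X;
  opfun :> X -> X;
  dom0 : dom 0;
  dom_linear : forall (a : R[i]) u v, dom u -> dom v -> dom (a *: u + v);
  opfun_linear : forall (a : R[i]) u v, dom u -> dom v ->
    opfun (a *: u + v) = a *: opfun u + opfun v }.

Definition same_operator (S T : operator) : Prop :=
  dom S = dom T /\ forall x, dom T x -> S x = T x.

Lemma opfun0 (T : operator) : T 0 = 0.
Proof.
have := opfun_linear 1 (dom0 T) (dom0 T).
by rewrite !scale1r addr0 => /(congr1 (fun y => y - T 0)); rewrite subrr addrK.
Qed.

Lemma domZ (T : operator) (c : R[i]) w : dom T w -> dom T (c *: w).
Proof. by move=> Tw; rewrite -[_ *: _]addr0; apply: dom_linear (dom0 T). Qed.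

Section Composition.
Variables S T : operator.

Let D : set X := [set x | dom T x /\ dom S (T x)].

Let D0 : D 0.
Proof. by split; rewrite ?opfun0; exact: dom0. Qed.

Let D_linear (a : R[i]) u v : D u -> D v -> D (a *: u + v).
Proof.
by move=> [? ?] [? ?]; split; rewrite ?opfun_linear//; exact: dom_linear.
Qed.

Let fun_linear (a : R[i]) u v : D u -> D v ->
  S (T (a *: u + v)) = a *: S (T u) + S (T v).
Proof. by move=> [? ?] [? ?]; rewrite !opfun_linear. Qed.

Definition op_comp : operator := Operator D0 D_linear fun_linear.

End Composition.

Section LeftMultiplication.
Variables (J : {linear X -> X}) (T : operator).

Let fun_linear (a : R[i]) u v : dom T u -> dom T v ->
  J (T (a *: u + v)) = a *: J (T u) + J (T v).
Proof. by move=> ? ?; rewrite opfun_linear// linearP. Qed.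

(* $JT$ *)
Definition op_lmul : operator :=
  Operator (dom0 T) (fun a u v => @dom_linear T a u v) fun_linear.

End LeftMultiplication.

Section LiJL.
Variables (L : operator) (J : {linear X -> X}).

Let D : set X := [set x | dom L x /\ dom L (J (L x))].

Let D0 : D 0.
Proof. by split; rewrite ?opfun0 ?linear0; exact: dom0. Qed.

Let D_linear (a : R[i]) u v : D u -> D v -> D (a *: u + v).
Proof.
move=> [? ?] [? ?]; split; first exact: dom_linear.
by rewrite opfun_linear// linearP; exact: dom_linear.
Qed.

Let fun_linear (a : R[i]) u v : D u -> D v ->
  L ('i%C *: J (L (a *: u + v))) =
  a *: L ('i%C *: J (L u)) + L ('i%C *: J (L v)).
Proof.
move=> [? ?] [? ?]; rewrite opfun_linear// linearP scalerDr scalerA mulrC.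
by rewrite -scalerA opfun_linear//; exact: domZ.
Qed.

(* $\Lambda iJ\Lambda$ *)
Definition op_LiJL : operator := Operator D0 D_linear fun_linear.

End LiJL.

(* Value of the inverse of an injective operator at a point of its range. *)
Definition op_inv (T : operator) (y : X) : X :=
  xget 0 [set x | dom T x /\ T x = y].

Definition resolvent_set (T : operator) : set R[i] :=
  [set z | (forall y, exists! x, dom T x /\ T x - z *: x = y) /\
           (exists M : R, forall x, dom T x ->
              `|x| <= M%:C * `|T x - z *: x|)].

Definition spectrum (T : operator) : set R[i] := ~` resolvent_set T.

Definition bounded_operator (J : X -> X) : Prop :=
  exists M : R, forall x, `|J x| <= M%:C * `|x|.

Variable dot : {dot X for conjC}.

Definition bounded_adjoint (J K : X -> X) : Prop :=
  forall x y, dot (J x) y = dot x (K y).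

(* The graph of $T^*$, for densely defined $T$. *)
Definition adjoint_graph (T : operator) : set (X * X) :=
  [set p | forall x, dom T x -> dot (T x) p.1 = dot x p.2].

Definition selfadjoint (T : operator) : Prop :=
  dense (dom T) /\ [set p : X * X | dom T p.1 /\ T p.1 = p.2] = adjoint_graph T.

Definition positive_sqrt (B L : operator) : Prop :=
  [/\ selfadjoint L, forall x, dom L x -> 0 <= dot (L x) x
    & same_operator (op_comp L L) B].

Definition tagged_sum (F : R -> R -> R -> X) (a : R) (s : seq R)
    (xi : nat -> R) : X :=
  \sum_(k < size s) F (xi k) (a :: s)`_k s`_k.

(* [I] is the limit, for the norm [nrm], of the sums of [F xi u v] over tagged
   partitions of [[a, b]], as the mesh tends to 0; here [[u, v]] runs over the
   cells of the partition and [xi] is the tag of the cell. In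
   [itv_partition a b s], the left endpoint [a] is not listed in [s]. *)
Definition tagged_limit (nrm : X -> R[i]) (F : R -> R -> R -> X) (a b : R)
    (I : X) : Prop :=
  forall e : R, 0 < e -> exists2 d : R, 0 < d &
    forall (s : seq R) (xi : nat -> R), itv_partition a b s ->
      (forall k, (k < size s)%N ->
         (a :: s)`_k <= xi k <= s`_k /\ s`_k - (a :: s)`_k < d) ->
      nrm (I - tagged_sum F a s xi) < e%:C.

(* $I = \int_a^b f(\omega)\,dE(\omega)Z$ *)
Definition stieltjes_integral (f : R -> R[i]) (E : R -> X -> X) (Z : X)
    (a b : R) (I : X) : Prop :=
  tagged_limit (fun x => `|x|) (fun xi u v => f xi *: (E v Z - E u Z)) a b I.

(* $I = \int_{-\infty}^{+\infty} f(\omega)\,dE(\omega)Z$ *)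
Definition spectral_integral (f : R -> R[i]) (E : R -> X -> X) (Z : X)
    (I : X) : Prop :=
  exists2 G : R -> R -> X,
    forall a b, a <= b -> stieltjes_integral f E Z a b (G a b) &
    G p.1 p.2 @[p --> filter_prod (ninfty_nbhs R) (pinfty_nbhs R)] --> I.

(* [E] is the spectral resolution of [T], normalized to be strongly
   right-continuous; the last clause is $T = \int\omega\,dE(\omega)$,
   domains included. *)
Definition spectral_resolution (T : operator) (E : R -> {linear X -> X}) :
    Prop :=
  [/\ forall w, bounded_adjoint (E w) (E w),
      forall v w x, E v (E w x) = E (Num.min v w) x,
      forall w x, E s x @[s --> w^'+] --> E w x,
      forall x, (E s x @[s --> -oo] --> (0 : X)) /\
                (E s x @[s --> +oo] --> x)
    & forall Z Y, (dom T Z /\ T Z = Y) <->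
        spectral_integral (fun w => w%:C) E Z Y].

(* $\mathcal V$ is [dom L], with the norm [vnorm L]. *)
Definition vnorm (L : operator) (x : X) : R[i] := `|L x|.

Definition continuous_in_V (L : operator) (x : R -> X) : Prop :=
  (forall t, dom L (x t)) /\
  forall (t e : R), 0 < e -> \forall s \near t, vnorm L (x s - x t) < e%:C.

(* [I] is the Riemann integral in $\mathcal V$ of [x] from 0 to [t], where [t]
   may be negative. *)
Definition V_integral (L : operator) (x : R -> X) (t : R) (I : X) : Prop :=
  let F (xi u v : R) := (v - u)%:C *: x xi in
  dom L I /\
  if 0 <= t then tagged_limit (vnorm L) F 0 t I
  else tagged_limit (vnorm L) F t 0 (- I).

Definition is_solution (L A : operator) (x : R -> X) : Prop :=
  continuous_in_V L x /\
  forall t, V_integral L x t (op_inv A (x t - x 0)).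

End Operators.

(* $e^{i\theta}$ *)
Definition expi (R : realType) (theta : R) : R[i] :=
  (cos theta +i* sin theta)%C.

(* Main.v *)
Require Import Defs.
From mathcomp Require Import all_boot all_order all_algebra.
From mathcomp Require Import sesquilinear complex.
From mathcomp Require Import all_classical all_reals all_analysis.
From mathcomp Require Import ring lra.

(* Put Z = Lambda X. The bounded operator Q = Lambda A^-1 Lambda^-1 equals
   i H^-1, is skew and injective, and the equation becomes
   Q (Z t - Z 0) = \int_0^t Z.
   Uniqueness: if D is the difference of two solutions, then (Q D)' = D, so
   |Q D|^2 has derivative 2 Re <D, Q D> = 0.
   Existence: Z t = \int e^{-i w t} dE(w) Z 0. On a bounded spectral subspace
   (E b - E a) X the Taylor formula of the exponential gives Z' = -i H Z, that
   is (Q Z)' = Z; the general case follows, since the truncations of Z converge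
   uniformly in t. *)

Set Implicit Arguments.
Unset Strict Implicit.
Unset Printing Implicit Defensive.

Import Order.TTheory GRing.Theory Num.Theory Num.Def.
Import numFieldNormedType.Exports.
Local Open Scope classical_set_scope.
Local Open Scope complex_scope.
Local Open Scope ring_scope.

(** For a general X in V the vector A X is undefined, so the equation is kept integrated in time:
    conjugation by Lambda turns the norm of V into that of the Hilbert space and leaves only the
    bounded operator Q. The link between Q and the spectral family is one implication, Q G = i y
    whenever G is the spectral integral of the coordinate at y, and it is applied to truncated
    vectors, on which that integral runs over a bounded interval. Estimates usually made with the
    measures d<E(w)z, z> are made on finite sums: the increments of E over disjoint cells are
    orthogonal projections that annihilate each other, so by Parseval a bound on every cell is a
    bound on the whole. The truncations converge uniformly in t because |e^{-iwt}| = 1: the spectral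
    tail of Z t is never larger than that of Z 0. *)

Lemma subrACA (V : zmodType) (x y z t : V) : x - y - (z - t) = x - z - (y - t).
Proof. by rewrite 2!opprD !opprK addrACA. Qed.

(** * Norms with real values *)

Section RealNorm.
Variable R : realType.

(** A norm with values in [R] gives access to the total order and to [lra]. *)
Definition rnorm (V : normedZmodType R[i]) (x : V) : R := complex.Re `|x|.

Lemma rnormE (V : normedZmodType R[i]) (x : V) : `|x| = (rnorm x)%:C.
Proof. by rewrite /rnorm RRe_real// realE normr_ge0. Qed.

Section Zmod.
Variable V : normedZmodType R[i].
Implicit Types x y : V.

Lemma rnorm_ge0 x : 0 <= rnorm x.
Proof. by rewrite -ler0c -rnormE. Qed.

Lemma rnorm0 : rnorm (0 : V) = 0.
Proof. by rewrite /rnorm normr0. Qed.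

Lemma rnorm_eq0 x : rnorm x = 0 -> x = 0.
Proof. by move=> x0; apply/eqP; rewrite -normr_eq0 rnormE x0. Qed.

Lemma rnormN x : rnorm (- x) = rnorm x.
Proof. by rewrite /rnorm normrN. Qed.

Lemma rdistC x y : rnorm (x - y) = rnorm (y - x).
Proof. by rewrite -opprB rnormN. Qed.

Lemma rnormD x y : rnorm (x + y) <= rnorm x + rnorm y.
Proof. by rewrite -lecR rmorphD/= -!rnormE ler_normD. Qed.

Lemma rnormB x y : rnorm (x - y) <= rnorm x + rnorm y.
Proof. by rewrite (le_trans (rnormD _ _))// rnormN. Qed.

Lemma rdistD z x y : rnorm (x - y) <= rnorm (x - z) + rnorm (z - y).
Proof. by rewrite (le_trans _ (rnormD _ _))// addrA subrK. Qed.

Lemma rnorm_sum n (F : 'I_n -> V) :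
  rnorm (\sum_(k < n) F k) <= \sum_(k < n) rnorm (F k).
Proof.
elim/big_ind2 : _ => //; first by rewrite rnorm0.
by move=> x1 x2 y1 y2 h1 h2; rewrite (le_trans (rnormD _ _))// lerD.
Qed.

End Zmod.

Lemma rnormM (x y : R[i]) : rnorm (x * y) = rnorm x * rnorm y.
Proof. by apply: complexI; rewrite rmorphM/= -!rnormE normrM. Qed.

Lemma rnormZ (V : normedModType R[i]) (c : R[i]) (x : V) :
  rnorm (c *: x) = rnorm c * rnorm x.
Proof. by apply: complexI; rewrite rmorphM/= -!rnormE normrZ. Qed.

Lemma rnorm_complex (a b : R) : rnorm (a +i* b) = Num.sqrt (a ^+ 2 + b ^+ 2).
Proof. by rewrite /rnorm normc_def. Qed.

Lemma rnormc_real (a : R) : rnorm a%:C = `|a|.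
Proof. by rewrite rnorm_complex expr0n addr0 sqrtr_sqr. Qed.

Lemma rnormc_le (a b : R) : rnorm (a +i* b) <= `|a| + `|b|.
Proof.
have -> : a +i* b = a%:C + 'i * b%:C by rewrite {1}[a +i* b]complexE.
rewrite (le_trans (rnormD _ _))// rnormM !rnormc_real lerD2l.
by rewrite rnorm_complex expr0n add0r expr1n sqrtr1 mul1r.
Qed.

Lemma rnorm_i : rnorm ('i : R[i]) = 1.
Proof. by rewrite rnorm_complex expr0n add0r expr1n sqrtr1. Qed.

Lemma rnormZr (V : normedModType R[i]) (c : R) (x : V) :
  rnorm (c%:C *: x) = `|c| * rnorm x.
Proof. by rewrite rnormZ rnormc_real. Qed.

End RealNorm.

(** * The real part of the inner product *)

Section Hilbert.
Variables (R : realType) (X : completeNormedModType R[i]).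
Variable dot : {dot X for conjC}.
Hypothesis dot_norm : forall x : X, `|x| ^+ 2 = dot x x.
Implicit Types x y z : X.

(** A real inner product with the same norm; orthogonality and skewness are used only through it. *)
Definition rdot x y : R := complex.Re (dot x y).

Lemma rnorm_sqr x : rnorm x ^+ 2 = rdot x x.
Proof. by rewrite /rdot -dot_norm rnormE -rmorphXn. Qed.

Lemma rdotC x y : rdot x y = rdot y x.
Proof.
have ReJ (c : R[i]) : complex.Re (conjC c) = complex.Re c by case: c.
by rewrite /rdot hermC expr0 mul1r; apply: ReJ.
Qed.

Lemma rdotDl x y z : rdot (x + y) z = rdot x z + rdot y z.
Proof. by rewrite /rdot linearDl raddfD. Qed.

Lemma rdotNl x z : rdot (- x) z = - rdot x z.
Proof. by rewrite /rdot linearNl raddfN. Qed.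

Lemma rdotBl x y z : rdot (x - y) z = rdot x z - rdot y z.
Proof. by rewrite rdotDl rdotNl. Qed.

Lemma rdotZl (a : R) x z : rdot (a%:C *: x) z = a * rdot x z.
Proof.
have ReM (c : R[i]) : complex.Re (a%:C * c) = a * complex.Re c.
  by case: c => u v /=; rewrite mul0r subr0.
by rewrite /rdot linearZl_LR; apply: ReM.
Qed.

Lemma rdotDr x y z : rdot z (x + y) = rdot z x + rdot z y.
Proof. by rewrite !(rdotC z) rdotDl. Qed.

Lemma rdotBr x y z : rdot z (x - y) = rdot z x - rdot z y.
Proof. by rewrite !(rdotC z) rdotBl. Qed.

Lemma rdotZr (a : R) x z : rdot z (a%:C *: x) = a * rdot z x.
Proof. by rewrite !(rdotC z) rdotZl. Qed.

Lemma rdot0l x : rdot 0 x = 0.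
Proof. by rewrite /rdot linear0l. Qed.

Lemma rdot0r x : rdot x 0 = 0.
Proof. by rewrite rdotC rdot0l. Qed.

Lemma rdot_suml n (F : 'I_n -> X) z :
  rdot (\sum_(k < n) F k) z = \sum_(k < n) rdot (F k) z.
Proof.
elim/big_ind2 : _ => //; first exact: rdot0l.
by move=> x1 x2 y1 y2 <- <-; rewrite rdotDl.
Qed.

Lemma rnorm_sqrB x y :
  rnorm (x - y) ^+ 2 = rnorm x ^+ 2 - 2 * rdot x y + rnorm y ^+ 2.
Proof. by rewrite !rnorm_sqr rdotBl !rdotBr (rdotC y x); ring. Qed.

Lemma rdot_le x y : rdot x y <= rnorm x * rnorm y.
Proof.
have [x0|x0] := eqVneq (rnorm x) 0.
  by rewrite (rnorm_eq0 x0) rdot0l rnorm0 mul0r.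
have [y0|y0] := eqVneq (rnorm y) 0.
  by rewrite (rnorm_eq0 y0) rdot0r rnorm0 mulr0.
have {}x0 : 0 < rnorm x by rewrite lt_neqAle eq_sym x0 rnorm_ge0.
have {}y0 : 0 < rnorm y by rewrite lt_neqAle eq_sym y0 rnorm_ge0.
have := sqr_ge0 (rnorm ((rnorm y)%:C *: x - (rnorm x)%:C *: y)).
rewrite rnorm_sqrB !rnormZr !ger0_norm ?rnorm_ge0// rdotZl rdotZr.
have -> : (rnorm y * rnorm x) ^+ 2 -
  2 * (rnorm y * (rnorm x * rdot x y)) + (rnorm x * rnorm y) ^+ 2 =
  2 * (rnorm x * rnorm y) * (rnorm x * rnorm y - rdot x y) by ring.
by rewrite pmulr_rge0 ?subr_ge0// !mulr_gt0.
Qed.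

Lemma norm_rdot_le x y : `|rdot x y| <= rnorm x * rnorm y.
Proof.
by rewrite ler_norml rdot_le andbT lerNl -rdotNl -(rnormN x) rdot_le.
Qed.

Lemma pythagoras n (F : 'I_n -> X) :
  (forall k l, k != l -> rdot (F k) (F l) = 0) ->
  rnorm (\sum_(k < n) F k) ^+ 2 = \sum_(k < n) rnorm (F k) ^+ 2.
Proof.
move=> F0; rewrite rnorm_sqr rdot_suml; apply: eq_bigr => k _.
rewrite rdotC rdot_suml (bigD1 k)//= big1 ?addr0 -?rnorm_sqr// => l lk.
exact: F0.
Qed.

End Hilbert.

(** * Sums of spectral increments *)

Section SpectralSums.
Variables (R : realType) (X : completeNormedModType R[i]).
Variable dot : {dot X for conjC}.
Hypothesis dot_norm : forall x : X, `|x| ^+ 2 = dot x x.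
Variable E : R -> {linear X -> X}.
Hypothesis E_adj : forall w, bounded_adjoint dot (E w) (E w).
Hypothesis E_min : forall v w x, E v (E w x) = E (Num.min v w) x.
Implicit Types (x y z : X) (u v w : R) (p : nat -> R) (c : nat -> R[i]).

(** For [u <= v], the orthogonal projection that the spectral family attaches to the interval ]u,
    v]. *)
Definition incr u v z := E v z - E u z.

Lemma incrD u v x y : incr u v (x + y) = incr u v x + incr u v y.
Proof. by rewrite /incr !linearD addrACA. Qed.

Lemma incrN u v x : incr u v (- x) = - incr u v x.
Proof. by rewrite /incr !linearN opprB opprK addrC. Qed.

Lemma incrB u v x y : incr u v (x - y) = incr u v x - incr u v y.
Proof. by rewrite incrD incrN. Qed.

Lemma incrZ u v (a : R[i]) x : incr u v (a *: x) = a *: incr u v x.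
Proof. by rewrite /incr !linearZ -scalerDr. Qed.

Lemma incr_sumr u v n (F : 'I_n -> X) :
  incr u v (\sum_(k < n) F k) = \sum_(k < n) incr u v (F k).
Proof. by rewrite /incr !linear_sum -big_split. Qed.

Lemma incr_comp u v u' v' z : incr u v (incr u' v' z) =
  E (Num.min v v') z - E (Num.min v u') z -
  (E (Num.min u v') z - E (Num.min u u') z).
Proof. by rewrite /incr (linearB (E v)) (linearB (E u)) !E_min. Qed.

Lemma incrC u v u' v' z : incr u v (incr u' v' z) = incr u' v' (incr u v z).
Proof.
rewrite !incr_comp ![Num.min v _]minC ![Num.min u _]minC.
by rewrite !opprB [LHS]addrACA [RHS]addrACA; congr (_ + _); rewrite addrC.
Qed.

Lemma incr_sub u v u' v' z : u <= u' -> u' <= v' -> v' <= v ->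
  incr u v (incr u' v' z) = incr u' v' z.
Proof.
move=> uu' u'v' v'v; rewrite incr_comp (min_r v'v) (min_r (le_trans u'v' v'v)).
by rewrite (min_l uu') (min_l (le_trans uu' u'v')) subrr subr0.
Qed.

Lemma incr_disjoint u v u' v' z : u <= v -> v <= u' -> u' <= v' ->
  incr u v (incr u' v' z) = 0.
Proof.
move=> uv vu' u'v'; rewrite incr_comp (min_l vu') (min_l (le_trans vu' u'v')).
by rewrite !min_l ?subrr// ?(le_trans uv)// (le_trans vu').
Qed.

Lemma rdot_incr u v x y : rdot dot (incr u v x) y = rdot dot x (incr u v y).
Proof. by rewrite rdotBl rdotBr /rdot !E_adj. Qed.

(** For a selfadjoint idempotent P, |P z|^2 = <z, P z>; Cauchy-Schwarz, then division by |P z|. *)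
Lemma rnorm_incr_le u v z : u <= v -> rnorm (incr u v z) <= rnorm z.
Proof.
move=> uv; have [->|z0] := eqVneq (incr u v z) 0.
  by rewrite rnorm0 rnorm_ge0.
have : 0 < rnorm (incr u v z).
  rewrite lt_neqAle rnorm_ge0 andbT eq_sym.
  by apply: contra z0 => /eqP/rnorm_eq0->.
move=> /ler_pM2r <-; rewrite -expr2 (rnorm_sqr dot_norm) rdot_incr.
by rewrite incr_sub// (rdot_le dot_norm).
Qed.

(** Required at all indices: a finite partition is continued by a constant sequence. *)
Definition nondec p := forall k, p k <= p k.+1.

Lemma nondec_le p j k : nondec p -> (j <= k)%N -> p j <= p k.
Proof. move=> pn; elim: k => [|k IH]; first by rewrite leqn0 => /eqP->.
by rewrite leq_eqVlt => /predU1P[->|/IH/le_trans]//; apply. Qed.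

Lemma incr_sum p n z :
  \sum_(k < n) incr (p k) (p k.+1) z = incr (p 0%N) (p n) z.
Proof.
rewrite -(big_mkord xpredT (fun k => incr (p k) (p k.+1) z)).
by rewrite telescope_sumr.
Qed.

Lemma incr_cells p j k z : nondec p -> j != k ->
  incr (p j) (p j.+1) (incr (p k) (p k.+1) z) = 0.
Proof.
move=> pn; rewrite neq_ltn => /orP[] jk.
  by rewrite incr_disjoint// nondec_le.
by rewrite incrC incr_disjoint// nondec_le.
Qed.

Lemma parseval p n z : nondec p ->
  rnorm (incr (p 0%N) (p n) z) ^+ 2 =
  \sum_(k < n) rnorm (incr (p k) (p k.+1) z) ^+ 2.
Proof.
move=> pn; rewrite -incr_sum (pythagoras dot_norm)// => k l kl.
by rewrite rdot_incr incr_cells ?rdot0r.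
Qed.

(** Plays the part of an estimate under the integral against d<E(w)z, z>: Parseval on both sides
    turns domination on each cell into domination of the norms. *)
Lemma rnorm_le_cells p n (e : R) y z : nondec p -> 0 <= e ->
  y = incr (p 0%N) (p n) y ->
  (forall k, (k < n)%N -> rnorm (incr (p k) (p k.+1) y) <=
                          e * rnorm (incr (p k) (p k.+1) z)) ->
  rnorm y <= e * rnorm (incr (p 0%N) (p n) z).
Proof.
move=> pn e0 yE H; rewrite {1}yE.
rewrite -(@ler_pXn2r _ 2)// ?nnegrE ?mulr_ge0 ?rnorm_ge0// exprMn !parseval//.
rewrite mulr_sumr ler_sum// => k _; rewrite -exprMn.
by apply: lerXn2r; rewrite ?nnegrE ?mulr_ge0 ?rnorm_ge0// H.
Qed.

(** The functional calculus of the step function equal to [c k] on the [k]-th cell. *)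
Definition ssum c p n z := \sum_(k < n) c k *: incr (p k) (p k.+1) z.

Lemma ssumB c p n x y : ssum c p n (x - y) = ssum c p n x - ssum c p n y.
Proof. by rewrite -sumrB; apply: eq_bigr => k _; rewrite incrB scalerBr. Qed.

Lemma incr_ssum c p n u v z :
  incr u v (ssum c p n z) = ssum c p n (incr u v z).
Proof.
by rewrite incr_sumr; apply: eq_bigr => k _; rewrite incrZ incrC.
Qed.

Lemma incr_cell_ssum c p n z k : nondec p -> (k < n)%N ->
  incr (p k) (p k.+1) (ssum c p n z) = c k *: incr (p k) (p k.+1) z.
Proof.
move=> pn kn; rewrite incr_sumr (bigD1 (Ordinal kn))//= incrZ incr_sub//.
rewrite big1 ?addr0// => l; rewrite -val_eqE/= => lk.
by rewrite incrZ incr_cells ?scaler0// eq_sym.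
Qed.

Lemma incr_hull_ssum c p n z : nondec p ->
  incr (p 0%N) (p n) (ssum c p n z) = ssum c p n z.
Proof.
move=> pn; rewrite -incr_sum; apply: eq_bigr => k _.
by rewrite incr_cell_ssum.
Qed.

(** Multiplicativity of the functional calculus on step functions: cells are idempotent and
    annihilate each other. *)
Lemma ssum_comp c c' p n z : nondec p ->
  ssum c p n (ssum c' p n z) = ssum (fun k => c k * c' k) p n z.
Proof.
by move=> pn; apply: eq_bigr => k _; rewrite incr_cell_ssum// scalerA.
Qed.

(** Restricting the bound to the cells that [z] charges allows a vector carried by a small interval
    to ignore all coefficients away from it. *)
Lemma rnorm_ssum_le c p n (e : R) z : nondec p -> 0 <= e ->
  (forall k, (k < n)%N -> incr (p k) (p k.+1) z != 0 -> rnorm (c k) <= e) ->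
  rnorm (ssum c p n z) <= e * rnorm (incr (p 0%N) (p n) z).
Proof.
move=> pn e0 H; apply: rnorm_le_cells; rewrite ?incr_hull_ssum// => k kn.
rewrite incr_cell_ssum// rnormZ.
have [->|z0] := eqVneq (incr (p k) (p k.+1) z) 0.
  by rewrite rnorm0 !mulr0.
by rewrite ler_wpM2r ?rnorm_ge0 ?H.
Qed.

(* Increments over disjoint cells annihilate each other, so only the cells
   that overlap [u, v] contribute. *)
Lemma incr_ssum_near c p n (u v e : R) (a : R[i]) z : nondec p -> 0 <= e ->
  p 0%N <= u -> u <= v -> v <= p n ->
  (forall k, (k < n)%N -> p k < v -> u < p k.+1 -> rnorm (c k - a) <= e) ->
  rnorm (incr u v (ssum c p n z) - a *: incr u v z) <=
  e * rnorm (incr u v z).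
Proof.
move=> pn e0 pu uv vp H; set w := incr u v z.
have -> : a *: w = ssum (fun=> a) p n w.
  by rewrite /ssum -scaler_sumr incr_sum incr_sub.
rewrite incr_ssum -/w -sumrB.
under eq_bigr do rewrite -scalerBl.
have {1}-> : w = incr (p 0%N) (p n) w by rewrite incr_sub.
rewrite -[\sum_(k < n) _]/(ssum (fun k => c k - a) p n _) -incr_ssum.
rewrite incr_hull_ssum//.
have -> : rnorm w = rnorm (incr (p 0%N) (p n) w) by rewrite incr_sub.
apply: rnorm_ssum_le => // k kn w0; apply: H => //.
- rewrite ltNge; apply: contra w0 => vk; apply/eqP.
  by rewrite incrC incr_disjoint.
- rewrite ltNge; apply: contra w0 => vk; apply/eqP.
  by rewrite incr_disjoint.
Qed.

(* Testing the difference against the cells of the first partition replaces a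
   common refinement. *)
Lemma ssum_near c c' p p' n m (e : R) z : nondec p -> nondec p' -> 0 <= e ->
  p' 0%N <= p 0%N -> p n <= p' m ->
  (forall k l, (k < n)%N -> (l < m)%N -> p' l < p k.+1 -> p k < p' l.+1 ->
     rnorm (c' l - c k) <= e) ->
  rnorm (incr (p 0%N) (p n) (ssum c' p' m z) - ssum c p n z) <= e * rnorm z.
Proof.
move=> pn pn' e0 p0 pnm H.
apply: (@le_trans _ _ (e * rnorm (incr (p 0%N) (p n) z))); last first.
  by rewrite ler_wpM2l// rnorm_incr_le// nondec_le.
apply: rnorm_le_cells => //.
  rewrite incrB incr_hull_ssum// incr_sub//; exact: nondec_le.
move=> k kn; rewrite incrB incr_cell_ssum//.
have [k0 kn1] : p 0%N <= p k /\ p k.+1 <= p n by split; exact: nondec_le.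
have -> : incr (p 0%N) (p n) (ssum c' p' m z) =
    ssum c' p' m (incr (p 0%N) (p n) z) by rewrite incr_ssum.
rewrite incr_ssum incrC incr_sub// -incr_ssum.
apply: incr_ssum_near => //; first exact: le_trans p0 k0.
  exact: le_trans kn1 pnm.
by move=> l lm h1 h2; exact: H.
Qed.

End SpectralSums.

(** * Partitions and spectral integrals over bounded intervals *)

Section Convergence.
Variables (R : realType) (X : completeNormedModType R[i]).

Lemma cvg_rnormP (T : Type) (F : set_system T) {FF : Filter F} (f : T -> X) l :
  f @ F --> l <-> forall e : R, 0 < e -> \forall t \near F, rnorm (l - f t) < e.
Proof.
split=> [/cvgrPdist_lt H e e0|H].
  have /H : 0 < e%:C by rewrite ltcR.
  by apply: filterS => t; rewrite rnormE ltcR.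
(* A positive element of [R[i]] is real, so real radii are enough. *)
apply/cvgrPdist_lt => -[a b]; rewrite ltcE/= => /andP[/eqP -> a0].
by apply: filterS (H _ a0) => t; rewrite rnormE -ltcR.
Qed.

Lemma complete_seq (u : nat -> X) :
  (forall e : R, 0 < e -> exists N, forall n m, (N <= n)%N -> (N <= m)%N ->
     rnorm (u n - u m) < e) ->
  exists l, forall e : R, 0 < e ->
    exists N, forall n, (N <= n)%N -> rnorm (l - u n) < e.
Proof.
move=> H; have : cvg (u @ \oo).
  apply/cauchy_cvgP/cauchy_exP => -[a b]; rewrite ltcE/= => /andP[/eqP -> a0].
  have [N HN] := H _ a0; exists (u N); exists N => // n /= Nn.
  by rewrite -ball_normE/= rnormE ltcR; exact: HN.
move=> /cvg_ex[l /cvg_rnormP ul]; exists l => e e0.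
by have [N _ HN] := ul _ e0; exists N => n Nn; exact: HN.
Qed.

(** The form in which limits as the mesh [d] tends to 0 are taken. [C] may have any sign, whence
    [|C| + 1] in the choice of [d], which keeps [C * d] below half of the gap [x - y]. *)
Lemma ler_addgt0_scaled (x y C : R) :
  (forall d, 0 < d -> x <= y + C * d) -> x <= y.
Proof.
move=> H; rewrite leNgt; apply/negP => yx.
have C1 : 0 < `|C| + 1 by rewrite ltr_wpDl.
have d0 : 0 < (x - y) / (2 * (`|C| + 1)).
  by rewrite divr_gt0 ?subr_gt0 ?mulr_gt0.
have := H _ d0; apply/negP; rewrite -ltNge -ltrBrDl.
rewrite mulrA ltr_pdivrMr ?mulr_gt0// mulrC ltr_pM2l ?subr_gt0//.
rewrite (le_lt_trans (ler_norm _))//; lra.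
Qed.

End Convergence.

Section TaggedPartitions.
Variable R : realType.
Implicit Types (a b d : R) (p xi : nat -> R).

(** Sequences instead of lists, and cells that may be degenerate, so that [a = b] is no special
    case. *)
Definition tagged_cells a b n p xi d : Prop :=
  [/\ p 0%N = a, p n = b, nondec p &
    forall k, (k < n)%N -> p k <= xi k <= p k.+1 /\ p k.+1 - p k < d].

(** The default value [b] of [nth] prolongs the list by its last point, as [nondec] demands. *)
Lemma itv_partition_tagged a b s xi d : itv_partition a b s ->
  (forall k, (k < size s)%N ->
     (a :: s)`_k <= xi k <= s`_k /\ s`_k - (a :: s)`_k < d) ->
  tagged_cells a b (size s) (nth b (a :: s)) xi d.
Proof.
move=> ps H.
have E k : (k <= size s)%N -> nth b (a :: s) k = (a :: s)`_k.
  by move=> ks; exact: set_nth_default.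
split => //.
- by rewrite (itv_partition_nth_size _ ps).
- move=> k; have [ks|sk] := ltnP k (size s).
    rewrite !E ?(ltnW ks)//=.
    by have [/andP[/le_trans + /[swap]] _] := H _ ks; apply.
  rewrite [leRHS]nth_default//=.
  move: sk; rewrite leq_eqVlt => /predU1P[<-|sk]; last by rewrite nth_default.
  by rewrite (itv_partition_nth_size _ ps).
- by move=> k ks; rewrite !E ?(ltnW ks)//; exact: H.
Qed.

Lemma tagged_sumE (X : completeNormedModType R[i]) (F : R -> R -> R -> X)
    a b s xi :
  tagged_sum F a s xi = \sum_(k < size s)
    F (xi k) (nth b (a :: s) k) (nth b (a :: s) k.+1).
Proof.
apply: eq_bigr => k _.
rewrite [(a :: s)`_k](set_nth_default b) ?[s`_k](set_nth_default b)//=.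
exact: leqW.
Qed.

Lemma ex_tagged a b d : a <= b -> 0 < d ->
  exists n p xi, tagged_cells a b n p xi d.
Proof.
(* More cells than (b - a) / d, so that each is shorter than [d]; a single cell of length 0 if
   [a = b]. *)
move=> ab d0; pose N := (Num.truncn ((b - a) / d)).+1.
have N0 : 0 < N%:R :> R by rewrite ltr0n.
pose h := (b - a) / N%:R.
have h0 : 0 <= h by rewrite divr_ge0 ?subr_ge0// ltW.
have hd : h < d.
  by rewrite ltr_pdivrMr// mulrC -ltr_pdivrMr//; exact: truncnS_gt.
pose p k := a + k%:R * h.
have pS k : p k.+1 = p k + h by rewrite /p -natr1; ring.
exists N, p, p; split.
- by rewrite /p mul0r addr0.
- by rewrite /p /h mulrCA divff ?lt0r_neq0// mulr1 addrC subrK.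
- by move=> k; rewrite pS lerDl.
- by move=> k _; rewrite pS lexx lerDl h0 addrC addKr.
Qed.

End TaggedPartitions.

Section SpectralIntegral.
Variables (R : realType) (X : completeNormedModType R[i]).
Variable dot : {dot X for conjC}.
Hypothesis dot_norm : forall x : X, `|x| ^+ 2 = dot x x.
Variable E : R -> {linear X -> X}.
Hypothesis E_adj : forall w, bounded_adjoint dot (E w) (E w).
Hypothesis E_min : forall v w x, E v (E w x) = E (Num.min v w) x.
Implicit Types (x y z I : X) (a b d C : R) (f : R -> R[i]).

Definition is_lipschitz f C := 0 <= C /\
  forall v w, rnorm (f v - f w) <= C * `|v - w|.

(* A quantitative form of [stieltjes_integral]. *)
Definition is_spint f a b z I := exists C, forall n p xi d,
  0 < d -> tagged_cells a b n p xi d ->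
  rnorm (I - ssum E (f \o xi) p n z) <= C * d.

(** Tags of two overlapping cells are at distance less than [d + d'], so [ssum_near] applies with
    the constant [C * (d + d')]. *)
Lemma ssum_lipschitz f C a b a' b' n m p p' xi xi' d d' z :
  is_lipschitz f C -> a' <= a -> b <= b' ->
  0 < d -> 0 < d' ->
  tagged_cells a b n p xi d -> tagged_cells a' b' m p' xi' d' ->
  rnorm (incr E a b (ssum E (f \o xi') p' m z) - ssum E (f \o xi) p n z) <=
  C * (d + d') * rnorm z.
Proof.
move=> [C0 fC] aa bb d0 d'0 [p0 pn pm pd] [p'0 p'n p'm p'd].
rewrite -p0 -pn; apply: (ssum_near dot_norm) => //; rewrite ?p0 ?p'0 ?pn ?p'n//.
  by rewrite mulr_ge0// addr_ge0// ltW.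
move=> k l kn lm h1 h2; rewrite (le_trans (fC _ _))// ler_wpM2l//.
have [/andP[k1 k2] k3] := pd _ kn; have [/andP[l1 l2] l3] := p'd _ lm.
by rewrite ler_norml; apply/andP; split; lra.
Qed.

Lemma ex_spint f C a b z : is_lipschitz f C -> a <= b ->
  exists I, is_spint f a b z I.
Proof.
move=> fC ab; have [C0 _] := fC.
pose d (N : nat) : R := N.+1%:R^-1.
have d0 N : 0 < d N by rewrite invr_gt0.
have /choice[T HT] : forall N, exists T : nat * (nat -> R) * (nat -> R),
    tagged_cells a b T.1.1 T.1.2 T.2 (d N).
  by move=> N; have [n [p [xi ?]]] := ex_tagged ab (d0 N); exists (n, p, xi).
pose u N := ssum E (f \o (T N).2) (T N).1.2 (T N).1.1 z.
have S n p xi e m : 0 < e -> tagged_cells a b n p xi e ->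
    rnorm (u m - ssum E (f \o xi) p n z) <= C * (e + d m) * rnorm z.
  move=> e0 t; have := ssum_lipschitz z fC (lexx a) (lexx b) e0 (d0 m) t (HT m).
  have [<- <- pm _] := HT m.
  by rewrite incr_hull_ssum.
have d_lt (e : R) : 0 < e -> exists N, forall m, (N <= m)%N -> d m < e.
  move=> e0; exists (Num.truncn e^-1) => m Nm.
  rewrite /d invf_plt ?posrE//; apply: lt_le_trans (truncnS_gt _) _.
  by rewrite ler_nat.
have [|l lP] := @complete_seq _ _ u.
  move=> e e0.
  have K0 : 0 < 2 * C * rnorm z + 1 by rewrite ltr_wpDl// !mulr_ge0// rnorm_ge0.
  have [N HN] := d_lt _ (divr_gt0 e0 K0).
  exists N => m k Nm Nk; rewrite (le_lt_trans (S _ _ _ _ m (d0 k) (HT k)))//.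
  have c1 : d k + d m <= 2 * (e / (2 * C * rnorm z + 1)).
    by have := HN _ Nm; have := HN _ Nk; lra.
  apply: (@le_lt_trans _ _ ((2 * C * rnorm z) * (e / (2 * C * rnorm z + 1)))).
    rewrite (_ : _ * rnorm z * _ =
        C * (2 * (e / (2 * C * rnorm z + 1))) * rnorm z).
      by rewrite ler_wpM2r ?rnorm_ge0// ler_wpM2l.
    by ring.
  rewrite mulrA ltr_pdivrMr// mulrC ltr_pM2l//; lra.
(* In [S], letting [d m] tend to 0 leaves the error [C * e * rnorm z]. *)
exists l, (C * rnorm z) => n p xi e e0 t.
apply: (@ler_addgt0_scaled _ _ _ (1 + C * rnorm z)) => c c0.
have [N HN] := lP _ c0; have [M HM] := d_lt _ c0.
pose m := maxn N M.
have h1 := HN m (leq_maxl _ _); have h2 := HM m (leq_maxr _ _).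
rewrite (le_trans (rdistD (u m) _ _))//.
have := S n p xi e m e0 t.
have : C * rnorm z * d m <= C * rnorm z * c.
  by rewrite ler_wpM2l ?mulr_ge0 ?rnorm_ge0// ltW.
move: h1; set A := rnorm _; set B := rnorm _; set D := rnorm z; lra.
Qed.


End SpectralIntegral.

(** * Lipschitz and Taylor bounds for the exponential *)

Section Exponential.
Variable R : realType.
Implicit Types x y h : R.

Lemma cos_lipschitz x y : `|cos x - cos y| <= `|x - y|.
Proof.
wlog xy : x y / y <= x => [H|].
  by have [/H//|/ltW/H] := leP y x; rewrite (distrC (cos _)) (distrC y).
have dcos (z : R) : z \in `]y, x[ -> is_derive z 1 cos (- sin z).
  by move=> _; exact: is_derive_cos.
have [c _ ->] := MVT_segment xy dcos (continuous_subspaceT (@continuous_cos R)).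
rewrite normrM normrN ler_piMl// ler_norml; apply/andP; split.
  exact: sin_geN1.
exact: sin_le1.
Qed.

Lemma sin_lipschitz x y : `|sin x - sin y| <= `|x - y|.
Proof.
wlog xy : x y / y <= x => [H|].
  by have [/H//|/ltW/H] := leP y x; rewrite (distrC (sin _)) (distrC y).
have dsin (z : R) : z \in `]y, x[ -> is_derive z 1 sin (cos z).
  by move=> _; exact: is_derive_sin.
have [c _ ->] := MVT_segment xy dsin (continuous_subspaceT (@continuous_sin R)).
rewrite normrM ler_piMl// ler_norml; apply/andP; split.
  exact: cos_geN1.
exact: cos_le1.
Qed.

(** Only the quadratic order matters: at the mean value point c the derivative is at most c <= h in
    absolute value, which gives the constant 1 in place of 1/2. *)
Lemma cos_sub1_le h : `|cos h - 1| <= h ^+ 2.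
Proof.
wlog h0 : h / 0 <= h => [H|].
  have [/H//|/ltW h0] := leP 0 h.
  by rewrite -cosN -sqrrN; apply: H; rewrite oppr_ge0.
have dcos (z : R) : z \in `]0, h[ -> is_derive z 1 cos (- sin z).
  by move=> _; exact: is_derive_cos.
have [c] := MVT_segment h0 dcos (continuous_subspaceT (@continuous_cos R)).
rewrite in_itv/= cos0 => /andP[c0 ch] ->.
rewrite normrM normrN subr0 (ger0_norm h0) expr2 ler_wpM2r//.
have := sin_lipschitz c 0; rewrite sin0 !subr0 => /le_trans; apply.
by rewrite ger0_norm.
Qed.

Lemma sin_subid_le h : `|sin h - h| <= h ^+ 2.
Proof.
wlog h0 : h / 0 <= h => [H|].
  have [/H//|/ltW h0] := leP 0 h.
  rewrite -normrN opprB addrC -sinN -{2}[h]opprK -sqrrN.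
  by apply: H; rewrite oppr_ge0.
have d z : is_derive (z : R) 1 (fun x => sin x - x) (cos z - 1).
  by apply: is_deriveB.
have cont : {within `[0, h], continuous (fun x : R => sin x - x)}.
  apply: derivable_within_continuous => z _.
  exact: (@ex_derive _ _ _ _ _ _ _ (d z)).
have [c] := MVT_segment h0 (fun z _ => d z) cont.
rewrite in_itv/= sin0 !subr0 => /andP[c0 ch] ->.
rewrite normrM (ger0_norm h0) expr2 ler_wpM2r//.
have := cos_lipschitz c 0; rewrite cos0 subr0 => /le_trans; apply.
by rewrite ger0_norm.
Qed.

Lemma rnorm_expi x : rnorm (expi x) = 1.
Proof. by rewrite rnorm_complex cos2Dsin2 sqrtr1. Qed.

Lemma expi0 : expi (0 : R) = 1.
Proof. by rewrite /expi cos0 sin0. Qed.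

Lemma expiD x y : expi (x + y) = expi x * expi y.
Proof.
rewrite /expi cosD sinD; apply/eqP; rewrite eq_complex/= eqxx/=.
by apply/eqP; rewrite addrC.
Qed.

Lemma expi_lipschitz x y : rnorm (expi x - expi y) <= 2 * `|x - y|.
Proof.
rewrite /expi (le_trans (rnormc_le _ _))// mulrDl mul1r.
by rewrite lerD ?cos_lipschitz ?sin_lipschitz.
Qed.

(** The factor [expi x] of modulus 1 reduces the bound to [x = 0]; the 2 adds the errors of cosine
    and sine. *)
Lemma expi_taylor x h :
  rnorm (expi (x + h) - expi x - h%:C * 'i * expi x) <= 2 * h ^+ 2.
Proof.
rewrite expiD -[X in _ - X - _]mulr1 (mulrC _ (expi x)) -!mulrBr rnormM.
rewrite rnorm_expi mul1r.
rewrite (_ : _ - _ = (cos h - 1) +i* (sin h - h)); last first.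
  apply/eqP; rewrite eq_complex/=; apply/andP; split; apply/eqP; ring.
rewrite (le_trans (rnormc_le _ _))// mulrDl mul1r.
by rewrite lerD ?cos_sub1_le ?sin_subid_le.
Qed.

End Exponential.

(** * Integrals of the exponential over bounded spectral intervals *)

Section SpectralIntegralTheory.
Variables (R : realType) (X : completeNormedModType R[i]).
Variable dot : {dot X for conjC}.
Hypothesis dot_norm : forall x : X, `|x| ^+ 2 = dot x x.
Variable E : R -> {linear X -> X}.
Hypothesis E_adj : forall w, bounded_adjoint dot (E w) (E w).
Hypothesis E_min : forall v w x, E v (E w x) = E (Num.min v w) x.
Implicit Types (x y z I : X) (a b d C s t : R) (f : R -> R[i]).

(** Projecting a sum over the large interval gives nearly a sum over the small one, by
    [ssum_lipschitz]. With equal endpoints this yields both uniqueness of the integral and its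
    invariance under the projection. *)
Lemma spint_restrict f C a b a' b' z I I' : is_lipschitz f C ->
  a' <= a -> a <= b -> b <= b' ->
  is_spint E f a b z I -> is_spint E f a' b' z I' -> incr E a b I' = I.
Proof.
move=> fC aa ab bb [D HD] [D' HD'].
apply/eqP; rewrite -subr_eq0; apply/eqP/rnorm_eq0/eqP.
rewrite eq_le rnorm_ge0 andbT.
apply: (@ler_addgt0_scaled _ _ _ (D' + C * 2 * rnorm z + D)) => d d0.
have [n [p [xi T]]] := ex_tagged ab d0.
have [n' [p' [xi' T']]] := ex_tagged (le_trans aa (le_trans ab bb)) d0.
have h := HD _ _ _ _ d0 T; have h' := HD' _ _ _ _ d0 T'.
have k := ssum_lipschitz dot_norm E_adj E_min z fC aa bb d0 d0 T T'.
rewrite (le_trans (rdistD (incr E a b (ssum E (f \o xi') p' n' z)) _ _))//.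
have := rdistD (ssum E (f \o xi) p n z)
  (incr E a b (ssum E (f \o xi') p' n' z)) I.
rewrite -incrB; have := rdistC (ssum E (f \o xi) p n z) I.
have := rnorm_incr_le dot_norm E_adj E_min (I' - ssum E (f \o xi') p' n' z) ab.
move: h h' k.
lra.
Qed.

Lemma spint_id f C a b z I : is_lipschitz f C -> a <= b ->
  is_spint E f a b z I -> incr E a b I = I.
Proof.
by move=> fC ab fI; exact: (spint_restrict fC (lexx a) ab (lexx b) fI fI).
Qed.

Lemma spint_uniq f C a b z I I' : is_lipschitz f C -> a <= b ->
  is_spint E f a b z I -> is_spint E f a b z I' -> I = I'.
Proof.
move=> fC ab fI fI'; rewrite -(spint_id fC ab fI').
by rewrite (spint_restrict fC (lexx a) ab (lexx b) fI fI').
Qed.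

Lemma spint_incr f a b u v z I : u <= v -> is_spint E f a b z I ->
  is_spint E f a b (incr E u v z) (incr E u v I).
Proof.
move=> uv [C HC]; exists C => n p xi d d0 T.
rewrite -incr_ssum// -incrB (le_trans _ (HC _ _ _ _ d0 T))//.
exact: (rnorm_incr_le dot_norm).
Qed.

(** The sums commute with the projections, so [I - incr E a b I] is the integral of
    [z - incr E a b z], and a function bounded by 1 contracts. *)
Lemma spint_tail f a b a' b' z I : (forall w, rnorm (f w) <= 1) ->
  a <= b -> a' <= b' -> is_spint E f a' b' z I ->
  rnorm (I - incr E a b I) <= rnorm (z - incr E a b z).
Proof.
move=> f1 ab ab' [C HC].
apply: (@ler_addgt0_scaled _ _ _ (2 * C)) => d d0.
have [n [p [xi T]]] := ex_tagged ab' d0.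
have h := HC _ _ _ _ d0 T; have [p0 pn pm _] := T.
set S := ssum E (f \o xi) p n z in h.
rewrite -[I - incr E a b I](subrK (S - incr E a b S)).
rewrite (le_trans (rnormD _ _))//.
have h1 := rnorm_incr_le dot_norm E_adj E_min (I - S) ab.
have : rnorm (I - incr E a b I - (S - incr E a b S)) <=
    rnorm (I - S) + rnorm (incr E a b (I - S)).
  by rewrite incrB subrACA rnormB.
have : rnorm (S - incr E a b S) <= rnorm (z - incr E a b z).
  rewrite /S incr_ssum// -ssumB.
  rewrite (le_trans (rnorm_ssum_le dot_norm E_adj E_min pm ler01 _))//.
    by move=> k _ _; exact: f1.
  by rewrite mul1r p0 pn; exact: (rnorm_incr_le dot_norm).
lra.
Qed.

Lemma spint_stieltjes f a b z I : is_spint E f a b z I ->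
  stieltjes_integral f E z a b I.
Proof.
move=> [C HC] e e0; have C1 : 0 < `|C| + 1 by rewrite ltr_wpDl.
exists (e / (`|C| + 1)); first exact: divr_gt0.
move=> s xi ps H; rewrite rnormE ltcR (tagged_sumE _ _ b).
have := HC _ _ _ _ (divr_gt0 e0 C1) (itv_partition_tagged ps H).
move/le_lt_trans; apply; rewrite mulrA ltr_pdivrMr// mulrC ltr_pM2l//.
by rewrite (le_lt_trans (ler_norm _))// ltrDl.
Qed.

Definition coordC (w : R) : R[i] := w%:C.

Definition wave t (w : R) : R[i] := expi (- (w * t)).

Lemma coordC_lipschitz : is_lipschitz coordC 1.
Proof.
by split=> // v w; rewrite mul1r /coordC -rmorphB/= rnormc_real.
Qed.

Lemma wave_lipschitz t : is_lipschitz (wave t) (2 * `|t|).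
Proof.
split=> [|v w]; first by rewrite mulr_ge0.
rewrite (le_trans (expi_lipschitz _ _))// -mulrA ler_wpM2l//.
by rewrite -opprD normrN -mulrBl normrM mulrC.
Qed.

Lemma wave_le1 t w : rnorm (wave t w) <= 1.
Proof. by rewrite rnorm_expi. Qed.

Section Generator.
Variables (a b : R) (ab : a <= b).
(** Bounds |w| on [a, b] whatever the signs, hence the norm of the generator on this spectral
    subspace. *)
Let M := `|a| + `|b|.

Lemma tagged_le n p xi d k :
  tagged_cells a b n p xi d -> (k < n)%N -> `|xi k| <= M.
Proof.
move=> [p0 pn pm pd] kn; have [/andP[h1 h2] _] := pd _ kn.
have h3 : a <= xi k by rewrite (le_trans _ h1)// -p0 nondec_le.
have h4 : xi k <= b by rewrite (le_trans h2)// -pn nondec_le.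
rewrite ler_norml; apply/andP; split.
  by have := ler_norm (- a); rewrite normrN /M; have := normr_ge0 b; lra.
by have := ler_norm b; rewrite /M; have := normr_ge0 a; lra.
Qed.

Lemma spint_wave_lipschitz s t z Ys Yt :
  is_spint E (wave s) a b z Ys -> is_spint E (wave t) a b z Yt ->
  rnorm (Ys - Yt) <= 2 * M * `|s - t| * rnorm z.
Proof.
move=> [C HC] [D HD]; apply: (@ler_addgt0_scaled _ _ _ (C + D)) => d d0.
have [n [p [xi T]]] := ex_tagged ab d0; have [p0 pn pm _] := T.
have := HC _ _ _ _ d0 T; have := HD _ _ _ _ d0 T.
set Ss := ssum E (wave s \o xi) p n z; set St := ssum E (wave t \o xi) p n z.
have : rnorm (Ss - St) <= 2 * M * `|s - t| * rnorm z.
  rewrite /Ss /St /ssum -sumrB; under eq_bigr do rewrite -scalerBl.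
  rewrite (le_trans (@rnorm_ssum_le _ _ dot dot_norm E E_adj E_min
    (fun k => wave s (xi k) - wave t (xi k)) _ _ (2 * M * `|s - t|) _ _ _ _))//.
  - by rewrite !mulr_ge0// addr_ge0.
  - move=> k kn _; rewrite (le_trans (expi_lipschitz _ _))//.
    rewrite -opprD normrN -mulrBr normrM mulrA.
    by rewrite ler_wpM2r// ler_wpM2l// (tagged_le T).
  - rewrite ler_wpM2l ?mulr_ge0 ?addr_ge0// p0 pn.
    exact: (rnorm_incr_le dot_norm).
have := rdistD Ss Ys Yt; have := rdistD St Ss Yt.
rewrite (rdistC St Yt); lra.
Qed.

(** The equation Y' = -i H Y on a bounded spectral subspace, with an error quadratic in the time
    step. All three integrals are replaced by sums over one common tagged partition. *)
Lemma spint_wave_derivative s t z Ys Yt Gt :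
  is_spint E (wave s) a b z Ys -> is_spint E (wave t) a b z Yt ->
  is_spint E coordC a b Yt Gt ->
  rnorm (Ys - Yt + ((s - t)%:C * 'i) *: Gt) <=
  2 * M ^+ 2 * (s - t) ^+ 2 * rnorm z.
Proof.
move=> [C HC] [D HD] [F HF].
apply: (@ler_addgt0_scaled _ _ _ (C + D + `|s - t| * (F + M * D))) => d d0.
have [n [p [xi T]]] := ex_tagged ab d0; have [p0 pn pm _] := T.
have := HC _ _ _ _ d0 T; have hD := HD _ _ _ _ d0 T; have := HF _ _ _ _ d0 T.
move: hD.
set Ss := ssum E (wave s \o xi) p n z; set St := ssum E (wave t \o xi) p n z.
set SG := ssum E _ p n Yt.
move=> hD hF hC.
have M0 : 0 <= M by rewrite addr_ge0.
(* With the inner integral [Yt] replaced by its sum [St], [ssum_comp] merges the two sums into that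
   of w e^{-iwt}, and the Taylor bound applies on each cell. *)
pose SS := ssum E (coordC \o xi) p n St.
have h1 : rnorm (SG - SS) <= M * (D * d).
  rewrite /SG /SS -ssumB.
  rewrite (le_trans (rnorm_ssum_le dot_norm E_adj E_min pm M0 _))//.
    by move=> k kn _; rewrite /= /coordC rnormc_real (tagged_le T).
  rewrite ler_wpM2l// (le_trans _ hD)// p0 pn.
  exact: (rnorm_incr_le dot_norm).
have h2 : rnorm (Ss - St + ((s - t)%:C * 'i) *: SS) <=
    2 * M ^+ 2 * (s - t) ^+ 2 * rnorm z.
  rewrite /SS ssum_comp// /Ss /St /ssum -sumrB scaler_sumr -big_split/=.
  under eq_bigr do rewrite scalerA -scalerBl -scalerDl.
  rewrite (le_trans (@rnorm_ssum_le _ _ dot dot_norm E E_adj E_min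
    (fun k => wave s (xi k) - wave t (xi k) + (s - t)%:C * 'i *
      (coordC (xi k) * wave t (xi k)))
    _ _ (2 * M ^+ 2 * (s - t) ^+ 2) _ _ _ _))//.
  - by rewrite mulr_ge0 ?sqr_ge0// mulr_ge0 ?sqr_ge0.
  - move=> k kn _; have := expi_taylor (- (xi k * t)) (- (xi k * (s - t))).
    rewrite (_ : - (xi k * t) + _ = - (xi k * s)); last ring.
    rewrite (_ : _ - _ * _ * _ = wave s (xi k) - wave t (xi k) +
      (s - t)%:C * 'i * (coordC (xi k) * wave t (xi k))); last first.
      by rewrite /wave /coordC !(rmorphN, rmorphM)/=; ring.
    move/le_trans; apply; rewrite sqrrN exprMn mulrA.
    rewrite ler_wpM2r ?sqr_ge0// ler_wpM2l//.
    by rewrite -[leLHS]real_normK ?num_real// lerXn2r ?nnegrE// (tagged_le T).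
  - rewrite ler_wpM2l ?p0 ?pn//; last exact: (rnorm_incr_le dot_norm).
    by rewrite mulr_ge0 ?sqr_ge0// mulr_ge0 ?sqr_ge0.
have h3 : rnorm (((s - t)%:C * 'i) *: (Gt - SS)) <=
    `|s - t| * (F * d + M * (D * d)).
  rewrite rnormZ rnormM rnormc_real rnorm_i mulr1 ler_wpM2l//.
  by rewrite (le_trans (rdistD SG _ _))// lerD.
have -> : Ys - Yt + ((s - t)%:C * 'i) *: Gt =
    (Ss - St + ((s - t)%:C * 'i) *: SS) + ((Ys - Ss) - (Yt - St)) +
    ((s - t)%:C * 'i) *: (Gt - SS).
  rewrite scalerBr subrACA; move: (Ss - St) (Ys - Yt) => P Q.
  by rewrite [_ + (Q - P)]addrC -!addrA addKr subrKC.
rewrite (le_trans (rnormD _ _))//.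
have := rnormD (Ss - St + ((s - t)%:C * 'i) *: SS) ((Ys - Ss) - (Yt - St)).
have := rnormB (Ys - Ss) (Yt - St).
lra.
Qed.

End Generator.
End SpectralIntegralTheory.

(** * Vector-valued primitives and Riemann sums *)

Section Primitive.
Variables (R : realType) (X : completeNormedModType R[i]).
Implicit Types (P Z : R -> X) (a b c d e s t u v : R) (x y z : X).

(** The mean value inequality taken as a definition. It survives uniform limits, and for uniformly
    continuous [Z] it gives back both the derivative of [P] and the convergence of the Riemann sums
    of [Z]. *)
Definition primitive P Z := forall u v x e, u <= v -> 0 <= e ->
  (forall s, u <= s <= v -> rnorm (Z s - x) <= e) ->
  rnorm (P v - P u - (v - u)%:C *: x) <= e * (v - u).

Lemma sum_cells (p : nat -> R) n : \sum_(k < n) (p k.+1 - p k) = p n - p 0%N.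
Proof.
by rewrite -(big_mkord xpredT (fun k => p k.+1 - p k)) telescope_sumr.
Qed.

Lemma sum_cellsX P (p : nat -> R) n :
  \sum_(k < n) (P (p k.+1) - P (p k)) = P (p n) - P (p 0%N).
Proof.
rewrite -(big_mkord xpredT (fun k => P (p k.+1) - P (p k))).
by rewrite (telescope_sumr (fun k => P (p k))).
Qed.

(** On a partition of mesh [d] the quadratic errors add up to at most [|K| * d * (v - u)], which
    vanishes with [d]. *)
Lemma primitive_quadratic P Z K :
  (forall s t, rnorm (P s - P t - (s - t)%:C *: Z t) <= K * (s - t) ^+ 2) ->
  primitive P Z.
Proof.
move=> H u v x e uv e0 Ze.
apply: (@ler_addgt0_scaled _ _ _ (`|K| * (v - u))) => d d0.
have [n [p [xi [p0 pn pm pd]]]] := ex_tagged uv d0.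
have -> : P v - P u - (v - u)%:C *: x =
    \sum_(k < n) (P (p k.+1) - P (p k) - (p k.+1 - p k)%:C *: x).
  by rewrite sumrB (sum_cellsX P p) -scaler_suml -rmorph_sum/= sum_cells p0 pn.
rewrite (le_trans (rnorm_sum _))//.
rewrite (_ : _ + _ = \sum_(k < n) (e + `|K| * d) * (p k.+1 - p k)); last first.
  by rewrite -mulr_sumr sum_cells p0 pn; ring.
apply: ler_sum => k _; have [/andP[_ _] kd] := pd _ (ltn_ord k).
have k0 : 0 <= p k.+1 - p k by rewrite subr_ge0.
have Zk : rnorm (Z (p k) - x) <= e.
  apply: Ze; rewrite -p0 -pn !nondec_le//; exact: ltnW.
rewrite (le_trans (rdistD ((p k.+1 - p k)%:C *: Z (p k)) _ _))//.
rewrite mulrDl [leRHS]addrC lerD//.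
  rewrite (le_trans (H _ _))// expr2 mulrA ler_wpM2r//.
  by rewrite (le_trans (ler_wpM2r k0 (ler_norm K)))// ler_wpM2l// ltW.
by rewrite -scalerBr rnormZr ger0_norm// mulrC ler_wpM2r.
Qed.

Lemma primitive_limit P Z :
  (forall e, 0 < e -> exists P' Z', [/\ primitive P' Z',
     forall s, rnorm (P s - P' s) <= e & forall s, rnorm (Z s - Z' s) <= e]) ->
  primitive P Z.
Proof.
move=> H u v x e uv e0 Ze.
(* The 2 counts the errors on [P] at both endpoints; [v - u] comes from the radius [e + d] for
   [Z']. *)
apply: (@ler_addgt0_scaled _ _ _ (2 + (v - u))) => d d0.
have [P' [Z' [PZ' PP' ZZ']]] := H _ d0.
have := PZ' u v x (e + d) uv (addr_ge0 e0 (ltW d0)).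
have /[swap]/[apply] : forall s, u <= s <= v -> rnorm (Z' s - x) <= e + d.
  move=> s us; rewrite (le_trans (rdistD (Z s) _ _))// addrC lerD ?Ze//.
  by rewrite rdistC.
have -> : P v - P u - (v - u)%:C *: x =
    (P' v - P' u - (v - u)%:C *: x) + (P v - P' v - (P u - P' u)).
  rewrite [X in _ = _ + X]subrACA; move: (P v - P u) (P' v - P' u) => A A'.
  by rewrite [RHS]addrC addrA subrK.
have := rnormD (P' v - P' u - (v - u)%:C *: x) (P v - P' v - (P u - P' u)).
have := rnormB (P v - P' v) (P u - P' u).
have := PP' u; have := PP' v; lra.
Qed.

Lemma primitive_sum P Z a b : primitive P Z -> a <= b ->
  (forall e, 0 < e -> exists2 d, 0 < d &
     forall s t, `|s - t| < d -> rnorm (Z s - Z t) <= e) ->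
  forall e, 0 < e -> exists2 d, 0 < d & forall n p xi,
    tagged_cells a b n p xi d ->
    rnorm (P b - P a - \sum_(k < n) (p k.+1 - p k)%:C *: Z (xi k)) < e.
Proof.
move=> PZ ab Zc e e0; have c0 : 0 < b - a + 1 by rewrite ltr_wpDl ?subr_ge0.
have [d d0 dP] := Zc _ (divr_gt0 e0 c0); exists d => // n p xi [p0 pn pm pd].
rewrite -pn -p0 -(sum_cellsX P p) -sumrB.
apply: (@le_lt_trans _ _ (e / (b - a + 1) * (b - a))); last first.
  by rewrite mulrAC ltr_pdivrMr// ltr_pM2l// ltrDl.
rewrite (le_trans (rnorm_sum _))//.
rewrite (_ : _ * _ = \sum_(k < n) e / (b - a + 1) * (p k.+1 - p k)); last first.
  by rewrite -mulr_sumr sum_cells pn p0.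
apply: ler_sum => k _; have [/andP[k1 k2] kd] := pd _ (ltn_ord k).
apply: PZ; [exact: pm|by rewrite ltW// divr_gt0|].
move=> s /andP[s1 s2]; apply: dP; rewrite ltr_norml; apply/andP; split; lra.
Qed.

Lemma primitive_derivative P Z : primitive P Z ->
  (forall t e, 0 < e -> exists2 d, 0 < d &
     forall s, `|s - t| < d -> rnorm (Z s - Z t) <= e) ->
  forall t e, 0 < e -> exists2 d, 0 < d & forall s, `|s - t| < d ->
     rnorm (P s - P t - (s - t)%:C *: Z t) <= e * `|s - t|.
Proof.
move=> PZ Zc t e e0; have [d d0 dP] := Zc t e e0; exists d => // s std.
have [ts|/ltW st] := leP t s.
  rewrite ger0_norm ?subr_ge0//; apply: PZ => // [|r /andP[r1 r2]].
    exact: ltW.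
  apply: dP; apply: le_lt_trans std.
  by rewrite !ger0_norm ?subr_ge0// lerB.
rewrite distrC ger0_norm ?subr_ge0// -rnormN opprB addrC opprB.
have -> : (s - t)%:C *: Z t = - ((t - s)%:C *: Z t).
  by rewrite -scaleNr -rmorphN opprB.
apply: PZ => // [|r /andP[r1 r2]]; first exact: ltW.
apply: dP; apply: le_lt_trans std.
by rewrite !ler0_norm ?subr_le0// !opprB lerB.
Qed.

End Primitive.

(** * Riemann limits and their splitting at a point *)

Section RiemannSums.
Variables (R : realType) (X : completeNormedModType R[i]).
Implicit Types (Z W : R -> X) (a b c d e t u v : R) (x y z I : X) (s : seq R).

Lemma ex_itv_partition a b d : a <= b -> 0 < d ->
  exists2 s, itv_partition a b s & path (fun u v => v - u < d) a s.
Proof.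
(* The points of [itv_partition] increase strictly: for [a = b] the list is empty. *)
rewrite le_eqVlt => /predU1P[->|ab] d0; first by exists [::] => //; split.
pose N := (Num.truncn ((b - a) / d)).+1.
have N0 : 0 < N%:R :> R by rewrite ltr0n.
pose h := (b - a) / N%:R.
have h0 : 0 < h by rewrite divr_gt0 ?subr_gt0.
have hd : h < d.
  by rewrite ltr_pdivrMr// mulrC -ltr_pdivrMr//; exact: truncnS_gt.
have H n : exists s, [/\ path <%O a s, last a s = a + n%:R * h
    & path (fun u v => v - u < d) a s].
  elim: n => [|n [s [s1 s2 s3]]]; first by exists [::]; rewrite mul0r addr0.
  exists (rcons s (a + n.+1%:R * h)); rewrite !rcons_path last_rcons s1 s2 s3/=.
  have -> : a + n.+1%:R * h = a + n%:R * h + h by rewrite -natr1; ring.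
  by rewrite ltrDl h0/= [X in X < d](_ : _ = h)//; ring.
have [s [s1 s2 s3]] := H N; exists s => //; split => //.
by rewrite s2 /h mulrCA divff ?lt0r_neq0// mulr1 addrC subrK.
Qed.

Lemma tagged_sum_cat (F : R -> R -> R -> X) a (s1 s2 : seq R) xi :
  tagged_sum F a (s1 ++ s2) xi =
  tagged_sum F a s1 xi +
  tagged_sum F (last a s1) s2 (fun k => xi (size s1 + k)%N).
Proof.
elim: s1 a xi => [|y s1 IH] a xi /=.
  by rewrite /tagged_sum big_ord0 add0r.
rewrite /tagged_sum /= !big_ord_recl -!/(tagged_sum _ _ _ _) /= -addrA.
congr (_ + _); exact: (IH y (fun k => xi k.+1)).
Qed.

Definition left_tag a s k : R := (a :: s)`_k.

Lemma left_tagP a b s xi d : itv_partition a b s ->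
  path (fun u v => v - u < d) a s ->
  (forall k, (k < size s)%N -> xi k = left_tag a s k) ->
  forall k, (k < size s)%N ->
     (a :: s)`_k <= xi k <= s`_k /\ s`_k - (a :: s)`_k < d.
Proof.
move=> [/(pathP 0) s1 _] /(pathP 0) s2 xiE k ks.
by rewrite xiE// lexx ltW/= ?s1//; split => //; exact: s2.
Qed.

Definition riemann_cell Z (xi u v : R) : X := (v - u)%:C *: Z xi.

Definition rlimit Z := tagged_limit (fun x => `|x|) (riemann_cell Z).

(** Only some Riemann sums, of whatever mesh, have to approach [I]. Differences of limits have this
    property at once, and it suffices for the mean value inequality. *)
Definition riemann_adherent Z a b I := forall e, 0 < e ->
  exists n p xi d, tagged_cells a b n p xi d /\
    rnorm (I - \sum_(k < n) riemann_cell Z (xi k) (p k) (p k.+1)) < e.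

Lemma rlimit_adherent Z a b I : a <= b -> rlimit Z a b I ->
  riemann_adherent Z a b I.
Proof.
move=> ab H e e0; have [d d0 dP] := H _ e0.
have [s s1 s2] := ex_itv_partition ab d0.
have T := left_tagP s1 s2 (fun _ _ => erefl).
exists (size s), (nth b (a :: s)), (left_tag a s), d; split.
  exact: itv_partition_tagged.
by rewrite -tagged_sumE -ltcR -rnormE; exact: dP.
Qed.

(** The partition is forced through [b], so that its sum splits, and made finer than a prescribed
    [d], so that either half can be compared with the limit on that half. *)
Lemma rlimit_cat Z a b c d e I : a <= b -> b <= c -> 0 < e -> 0 < d ->
  rlimit Z a c I -> exists s1 s2 xi1 xi2,
  [/\ itv_partition a b s1, itv_partition b c s2,
   (forall k, (k < size s1)%N ->
     (a :: s1)`_k <= xi1 k <= s1`_k /\ s1`_k - (a :: s1)`_k < d),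
   (forall k, (k < size s2)%N ->
     (b :: s2)`_k <= xi2 k <= s2`_k /\ s2`_k - (b :: s2)`_k < d)
   & rnorm (I - (tagged_sum (riemann_cell Z) a s1 xi1 +
                 tagged_sum (riemann_cell Z) b s2 xi2)) < e].
Proof.
move=> ab bc e0 d0 H; have [d' d'0 dP] := H _ e0.
have m0 : 0 < Num.min d d' by rewrite lt_min d0.
have [s1 p1 q1] := ex_itv_partition ab m0.
have [s2 p2 q2] := ex_itv_partition bc m0.
have l1 : last a s1 = b by have [_ /eqP] := p1.
pose xi := left_tag a (s1 ++ s2).
have xi1 k : (k < size s1)%N -> xi k = left_tag a s1 k.
  by move=> ks; rewrite /xi /left_tag -cat_cons nth_cat/= ltnS ltnW.
have xi2 k : (k < size s2)%N -> xi (size s1 + k)%N = left_tag b s2 k.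
  (* The first cell of the second half starts at the last point of [s1], which is [b]; the index is
     shifted by one for the others. *)
  move=> ks; rewrite /xi /left_tag -l1; case: k ks => [|k] ks.
    by rewrite addn0 -cat_cons nth_cat/= ltnSn -last_nth.
  by rewrite addnS/= nth_cat ltnNge leq_addr/= addKn.
exists s1, s2, xi, (fun k => xi (size s1 + k)%N).
have W a' b' s : itv_partition a' b' s ->
    path (fun u v => v - u < Num.min d d') a' s ->
    path (fun u v => v - u < d) a' s.
  by move=> _; apply: sub_path => x y /=; rewrite lt_min => /andP[].
split => //.
- exact: left_tagP p1 (W _ _ _ p1 q1) xi1.
- exact: left_tagP p2 (W _ _ _ p2 q2) xi2.
rewrite -ltcR -rnormE -[X in tagged_sum _ X s2]l1 -tagged_sum_cat; apply: dP.
  exact: itv_partition_cat p1 p2.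
apply: (left_tagP (itv_partition_cat p1 p2)) => //.
rewrite cat_path l1; apply/andP; split.
  by move: q1; apply: sub_path => x y /=; rewrite lt_min => /andP[].
by move: q2; apply: sub_path => x y /=; rewrite lt_min => /andP[].
Qed.

Lemma rlimit_subr Z a b c I I' : a <= b -> b <= c -> rlimit Z a b I ->
  rlimit Z a c I' -> riemann_adherent Z b c (I' - I).
Proof.
move=> ab bc H H' e e0; have e2 : 0 < e / 2 by rewrite divr_gt0.
have [d d0 dP] := H _ e2.
have [s1 [s2 [xi1 [xi2 [p1 p2 t1 t2 h]]]]] := rlimit_cat ab bc e2 d0 H'.
exists (size s2), (nth c (b :: s2)), xi2, d; split.
  exact: itv_partition_tagged.
rewrite -tagged_sumE.
have := dP _ _ p1 t1; rewrite rnormE ltcR => h1.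
rewrite (_ : _ - _ - _ = (I' - (tagged_sum (riemann_cell Z) a s1 xi1 +
   tagged_sum (riemann_cell Z) b s2 xi2)) -
   (I - tagged_sum (riemann_cell Z) a s1 xi1)); last first.
  by rewrite subrACA [_ + _ - tagged_sum _ a s1 _]addrC addKr.
rewrite (le_lt_trans (rnormB _ _))// (lt_le_trans (ltrD h h1))//; lra.
Qed.

Lemma rlimit_subl Z a b c I I' : a <= b -> b <= c -> rlimit Z b c I ->
  rlimit Z a c I' -> riemann_adherent Z a b (I' - I).
Proof.
move=> ab bc H H' e e0; have e2 : 0 < e / 2 by rewrite divr_gt0.
have [d d0 dP] := H _ e2.
have [s1 [s2 [xi1 [xi2 [p1 p2 t1 t2 h]]]]] := rlimit_cat ab bc e2 d0 H'.
exists (size s1), (nth b (a :: s1)), xi1, d; split.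
  exact: itv_partition_tagged.
rewrite -tagged_sumE.
have := dP _ _ p2 t2; rewrite rnormE ltcR => h1.
rewrite (_ : _ - _ - _ = (I' - (tagged_sum (riemann_cell Z) a s1 xi1 +
   tagged_sum (riemann_cell Z) b s2 xi2)) -
   (I - tagged_sum (riemann_cell Z) b s2 xi2)); last first.
  by rewrite subrACA addrK.
rewrite (le_lt_trans (rnormB _ _))// (lt_le_trans (ltrD h h1))//; lra.
Qed.

Lemma riemann_adherent_le Z a b I x e : a <= b -> 0 <= e ->
  riemann_adherent Z a b I ->
  (forall t, a <= t <= b -> rnorm (Z t - x) <= e) ->
  rnorm (I - (b - a)%:C *: x) <= e * (b - a).
Proof.
move=> ab e0 H Ze; apply: (@ler_addgt0_scaled _ _ _ 1) => d d0.
have [n [p [xi [c [[p0 pn pm pc] h]]]]] := H _ d0.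
set S := \sum_(k < n) _ in h.
rewrite (le_trans (rdistD S _ _))// addrC mul1r lerD ?(ltW h)//.
rewrite -pn -p0 -sum_cells rmorph_sum scaler_suml mulr_sumr -sumrB.
rewrite (le_trans (rnorm_sum _))//; apply: ler_sum => k _.
have [/andP[k1 k2] _] := pc _ (ltn_ord k).
rewrite -scalerBr rnormZr ger0_norm ?subr_ge0// mulrC ler_wpM2r ?subr_ge0//.
rewrite Ze//.
rewrite (le_trans _ k1) ?(le_trans k2)//= -?p0 -?pn nondec_le//.
Qed.

End RiemannSums.

Lemma rlimit_primitive (R : realType) (X : completeNormedModType R[i])
    (W Z : R -> X) :
  (forall t, if 0 <= t then rlimit Z 0 t (W t) else rlimit Z t 0 (- W t)) ->
  primitive W Z.
Proof.
move=> H u v x e uv e0 Ze.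
have [u0|u0] := leP 0 u.
  have v0 := le_trans u0 uv.
  move: (H u) (H v); rewrite u0 v0 => Hu Hv.
  exact: riemann_adherent_le (rlimit_subr u0 uv Hu Hv) Ze.
have [v0|v0] := leP 0 v; last first.
  move: (H u) (H v); rewrite (leNgt 0 u) (leNgt 0 v) u0 v0 /= => Hu Hv.
  have := riemann_adherent_le uv e0 (rlimit_subl uv (ltW v0) Hv Hu) Ze.
  by rewrite opprK [- W u + _]addrC.
(* Here 0 lies in [u, v]: the two halves are estimated around the same [x] and added. *)
move: (H u) (H v); rewrite (leNgt 0 u) u0 v0 /= => Hu Hv.
have Ze1 t : u <= t <= 0 -> rnorm (Z t - x) <= e.
  by move=> /andP[h1 h2]; apply: Ze; rewrite h1 (le_trans h2).
have Ze2 t : 0 <= t <= v -> rnorm (Z t - x) <= e.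
  by move=> /andP[h1 h2]; apply: Ze; rewrite h2 (le_trans (ltW u0)).
have h1 := riemann_adherent_le (ltW u0) e0 (rlimit_adherent (ltW u0) Hu) Ze1.
have h2 := riemann_adherent_le v0 e0 (rlimit_adherent v0 Hv) Ze2.
have -> : W v - W u - (v - u)%:C *: x =
    (W v - (v - 0)%:C *: x) + (- W u - (0 - u)%:C *: x).
  rewrite addrACA -opprD -scalerDl -rmorphD/=; congr (_ - _%:C *: _).
  by rewrite subr0 sub0r.
rewrite (le_trans (rnormD _ _))// (le_trans (lerD h2 h1))//.
by rewrite -mulrDr subr0 sub0r.
Qed.

Lemma is_derive_zero_cst (R : realType) (f : R -> R) :
  (forall t e, 0 < e -> exists2 d, 0 < d &
     forall s, `|s - t| < d -> `|f s - f t| <= e * `|s - t|) ->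
  forall s t, f s = f t.
Proof.
move=> H s t; apply: is_derive_0_is_cst => r.
have L : h^-1 *: ((f \o shift r) (h *: (1 : R)) - f r) @[h --> 0^'] --> (0 : R).
  apply/cvgrPdist_le => e e0; have [d d0 dP] := H r _ e0.
  near=> h.
  have h0 : h != 0 by near: h; exact: nbhs_dnbhs_neq.
  rewrite /= sub0r normrN normrZ normrV ?unitfE// scaler1.
  rewrite ler_pdivrMl ?normr_gt0// mulrC.
  have := dP (h + r); rewrite addrK; apply.
  by near: h; apply: dnbhs0_lt.
by apply: DeriveDef; [apply/cvg_ex; exists 0|exact: cvg_lim].
Unshelve. all: by end_near. Qed.

(** * Uniqueness for a skew injective operator *)

Section SkewFlow.
Variables (R : realType) (X : completeNormedModType R[i]).
Variable dot : {dot X for conjC}.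
Hypothesis dot_norm : forall x : X, `|x| ^+ 2 = dot x x.
Variable Q : X -> X.
Hypothesis Q_skew : forall x, rdot dot (Q x) x = 0.
Hypothesis Q_inj : forall x, Q x = 0 -> x = 0.

Lemma skew_flow_eq0 (D : R -> X) :
  (forall t e, 0 < e -> exists2 d, 0 < d & forall s, `|s - t| < d ->
     rnorm (Q (D s) - Q (D t) - (s - t)%:C *: D t) <= e * `|s - t|) ->
  Q (D 0) = 0 -> forall t, D t = 0.
Proof.
move=> H D0 t; apply: Q_inj; apply: rnorm_eq0; apply/eqP.
rewrite -sqrf_eq0 -(_ : rnorm (Q (D 0)) ^+ 2 = rnorm (Q (D t)) ^+ 2).
  by rewrite D0 rnorm0 expr0n.
apply: (@is_derive_zero_cst _ (fun t => rnorm (Q (D t)) ^+ 2)) => {}t e e0.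
(* Collects the cross term, [2 * rnorm (Q (D t))], and the square of the increment, at most
   [(rnorm (D t) + 1) ^+ 2] times [|s - t| ^+ 2]. Taking [e' <= 1] bounds [r] by [|s - t|], and
   [|s - t| < e'] makes the square small to first order. *)
pose K := 2 * rnorm (Q (D t)) + (rnorm (D t) + 1) ^+ 2 + 1.
have K0 : 0 < K by rewrite ltr_wpDl// addr_ge0 ?sqr_ge0// mulr_ge0 ?rnorm_ge0.
pose e' := Num.min 1 (e / K).
have e'0 : 0 < e' by rewrite lt_min ltr01 divr_gt0.
have [e'1 e'K] : e' <= 1 /\ e' * K <= e.
  by rewrite -ler_pdivlMr// /e'; split; rewrite ge_min lexx ?orbT.
have [d d0 dP] := H t _ e'0.
exists (Num.min d e'); first by rewrite lt_min d0.
move=> s; rewrite lt_min => /andP[/dP h1 h2].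
set r := _ - _ - _ in h1; pose W := Q (D t).
have -> : Q (D s) = W + ((s - t)%:C *: D t + r).
  by rewrite /r [_ *: _ + _]addrC subrK /W addrC subrK.
set w := _ *: _ + r.
have -> : rnorm (W + w) ^+ 2 - rnorm (Q (D t)) ^+ 2 =
    2 * rdot dot r W + rnorm w ^+ 2.
  (* The first-order part of [w] is along [D t], which is orthogonal to [W = Q (D t)]. *)
  have -> : rdot dot r W = rdot dot w W.
    rewrite /w (rdotDl _ ((s - t)%:C *: D t) r) rdotZl.
    by rewrite (rdotC _ (D t)) Q_skew mulr0 add0r.
  rewrite -/W; move: w W => y x; rewrite !(rnorm_sqr dot_norm).
  by rewrite rdotDl !rdotDr (rdotC _ x y); ring.
have h3 : `|2 * rdot dot r W| <= 2 * (e' * `|s - t| * rnorm W).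
  rewrite normrM ger0_norm// ler_wpM2l//.
  rewrite (le_trans (norm_rdot_le dot_norm _ _))//.
  by rewrite ler_wpM2r// rnorm_ge0.
have h4 : rnorm w <= `|s - t| * (rnorm (D t) + 1).
  rewrite (le_trans (rnormD _ _))// rnormZr mulrDr lerD2l mulr1.
  by rewrite (le_trans h1)// ler_piMl.
have h5 : rnorm w ^+ 2 <= e' * `|s - t| * (rnorm (D t) + 1) ^+ 2.
  rewrite expr2 (le_trans (ler_pM _ _ h4 h4)) ?rnorm_ge0//.
  rewrite mulrACA -expr2 ler_wpM2r ?sqr_ge0// ler_wpM2r//; exact: ltW.
rewrite (le_trans (ler_normD _ _))// [X in _ + X]ger0_norm ?sqr_ge0//.
rewrite (le_trans (lerD h3 h5))//.
apply: (@le_trans _ _ (e' * K * `|s - t|)); last by rewrite ler_wpM2r.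
rewrite [leRHS]mulrAC /K -/W.
have : 0 <= e' * `|s - t| by rewrite mulr_ge0// ltW.
move: (e' * `|s - t|) => y; lra.
Qed.

End SkewFlow.

(** * The spectral integral of the exponential *)

Section SpectralFlow.
Variables (R : realType) (X : completeNormedModType R[i]).
Variable dot : {dot X for conjC}.
Hypothesis dot_norm : forall x : X, `|x| ^+ 2 = dot x x.
Variable E : R -> {linear X -> X}.
Hypothesis E_adj : forall w, bounded_adjoint dot (E w) (E w).
Hypothesis E_min : forall v w x, E v (E w x) = E (Num.min v w) x.
Hypothesis E_lim : forall x, (E s x @[s --> -oo] --> (0 : X)) /\
                             (E s x @[s --> +oo] --> x).
Implicit Types (x y z I G : X) (a b d e s t : R) (f : R -> R[i]).

Lemma incr_cvg z e : 0 < e -> exists2 N : R, 0 <= N & forall a b,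
  a <= - N -> N <= b -> rnorm (z - incr E a b z) < e.
Proof.
move=> e0; have e2 : 0 < e / 2 by rewrite divr_gt0.
have [/cvg_rnormP/(_ _ e2)[A [Ar HA]] /cvg_rnormP/(_ _ e2)[B [Br HB]]] :=
  E_lim z.
exists (`|A| + `|B| + 1) => [|a b aN Nb]; first by rewrite !addr_ge0.
have hA := ler_norm (- A); have hB := ler_norm B; rewrite normrN in hA.
have /HA : a < A by have := normr_ge0 B; lra.
have /HB : B < b by have := normr_ge0 A; lra.
rewrite sub0r rnormN => h1 h2.
have -> : z - incr E a b z = (z - E b z) + E a z by rewrite opprB addrA addrAC.
by rewrite (le_lt_trans (rnormD _ _))// (lt_le_trans (ltrD h1 h2))//; lra.
Qed.

Lemma incr_dense z : (forall a b, a <= b -> incr E a b z = 0) -> z = 0.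
Proof.
move=> H; apply: rnorm_eq0; apply/eqP; rewrite eq_le rnorm_ge0 andbT.
apply: (@ler_addgt0_scaled _ _ _ 1) => e e0.
have [N N0 /(_ (- N) N (lexx _) (lexx _))] := incr_cvg z e0.
by rewrite H ?subr0 ?add0r ?mul1r; [move/ltW|lra].
Qed.

(** The integrals over [-n, n] form a Cauchy sequence because their tails are dominated by those of
    [z]. Stating that each cut [incr E a b (Y t)] is the integral over [a, b] reduces later claims
    on [Y] to bounded intervals. *)
Lemma ex_flow z : exists Y : R -> X, forall t a b, a <= b ->
  is_spint E (wave t) a b z (incr E a b (Y t)).
Proof.
suff H t : exists Y, forall a b, a <= b ->
    is_spint E (wave t) a b z (incr E a b Y).
  by have /choice[Y HY] := H; exists Y.
have lip := wave_lipschitz (t : R).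
pose r (n : nat) : R := n%:R.
have r0 n : - r n <= r n by have := ler0n R n; rewrite /r; lra.
have /choice[u uP] : forall n, exists I, is_spint E (wave t) (- r n) (r n) z I.
  by move=> n; exact: (ex_spint dot_norm E_adj E_min z lip (r0 n)).
have restr n a b I : a <= b -> - r n <= a -> b <= r n ->
    is_spint E (wave t) a b z I -> incr E a b (u n) = I.
  move=> ab an bn HI.
  exact: (spint_restrict dot_norm E_adj E_min lip an ab bn HI (uP n)).
have r_mono n m : (n <= m)%N -> r n <= r m by rewrite /r ler_nat.
have near_u (e : R) : 0 < e -> exists N, forall n, (N <= n)%N ->
    rnorm (u n - u N) < e.
  move=> e0; have [M M0 HM] := incr_cvg z e0.
  have MN : M <= r (Num.truncn M).+1 by exact/ltW/truncnS_gt.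
  exists (Num.truncn M).+1 => n Nn.
  rewrite -(restr n _ _ _ (r0 _) _ _ (uP (Num.truncn M).+1)) ?lerN2 ?r_mono//.
  apply: le_lt_trans
    (spint_tail dot_norm E_adj E_min (@wave_le1 _ t) (r0 _) (r0 _) (uP n)) _.
  by apply: HM => //; rewrite lerN2.
have [|Y HY] := @complete_seq _ _ u.
  move=> e e0; have e2 : 0 < e / 2 by rewrite divr_gt0.
  have [N HN] := near_u _ e2; exists N => n m Nn Nm.
  rewrite (le_lt_trans (rdistD (u N) _ _))// (rdistC (u N)).
  by rewrite (lt_le_trans (ltrD (HN _ Nn) (HN _ Nm)))//; lra.
exists Y => a b ab; have [I HI] := ex_spint dot_norm E_adj E_min z lip ab.
suff -> : incr E a b Y = I by [].
apply/eqP; rewrite -subr_eq0; apply/eqP/rnorm_eq0/eqP.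
rewrite eq_le rnorm_ge0 andbT; apply: (@ler_addgt0_scaled _ _ _ 1) => e e0.
have [N HN] := HY _ e0.
pose n := maxn N (Num.truncn (`|a| + `|b|)).+1.
have nr : `|a| + `|b| <= r n.
  by rewrite (le_trans (ltW (truncnS_gt _)))// r_mono// leq_maxr.
have an : - r n <= a.
  by have := ler_norm (- a); have := normr_ge0 b; rewrite normrN; lra.
have bn : b <= r n by have := ler_norm b; have := normr_ge0 a; lra.
rewrite -(restr n _ _ _ ab an bn HI) -incrB add0r mul1r.
rewrite (le_trans (rnorm_incr_le dot_norm E_adj E_min _ ab))//.
by rewrite ltW// HN// leq_maxl.
Qed.

Lemma spectral_integral_incr f z Y :
  (forall a b, a <= b -> is_spint E f a b z (incr E a b Y)) ->
  spectral_integral f E z Y.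
Proof.
move=> H; exists (fun a b => incr E a b Y).
  by move=> a b ab; apply: spint_stieltjes; exact: H.
apply/cvg_rnormP => e e0; have [N N0 HN] := incr_cvg Y e0.
exists ([set a | a < - N], [set b | N < b]) => /=.
  by split; [exists (- N)|exists N]; split => //; rewrite num_real.
by move=> [a b]/= [aN Nb]; apply: HN; exact: ltW.
Qed.

(** For [y] in a bounded spectral subspace all integrals over larger intervals equal [G]: the
    improper limit is stationary. Pairs that are out of order get an arbitrary value. *)
Lemma spectral_integral_coord a b y G : a <= b -> incr E a b y = y ->
  is_spint E (@coordC R) a b y G -> spectral_integral (fun w => w%:C) E y G.
Proof.
move=> ab yab HG; have lip := coordC_lipschitz R.
have /choice[I HI] : forall p : R * R, exists I,
    p.1 <= p.2 -> is_spint E (@coordC R) p.1 p.2 y I.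
  move=> p; have [p12|_] := leP p.1 p.2; last by exists 0.
  by have [I HI] := ex_spint dot_norm E_adj E_min y lip p12; exists I.
exists (fun a' b' => I (a', b')).
  by move=> a' b' ab'; apply: spint_stieltjes; exact: (HI (a', b')).
apply/cvg_rnormP => e e0.
exists ([set a' | a' < a], [set b' | b < b']) => /=.
  by split; [exists a|exists b]; split => //; rewrite num_real.
move=> [a' b']/= [/ltW aa /ltW bb].
have ab' : a' <= b' := le_trans aa (le_trans ab bb).
have H := HI (a', b') ab'.
rewrite -(spint_restrict dot_norm E_adj E_min lip aa ab bb HG H).
have := spint_incr dot_norm E_adj E_min ab H; rewrite yab => H'.
by rewrite (spint_uniq dot_norm E_adj E_min lip ab' H' H) subrr rnorm0.
Qed.

Section Generator.
Variable Q : X -> X.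
Hypothesis Q_lin : forall (c : R[i]) x y, Q (c *: x + y) = c *: Q x + Q y.
Variable M : R.
Hypothesis M_ge0 : 0 <= M.
Hypothesis Q_le : forall x, rnorm (Q x) <= M * rnorm x.
Hypothesis Q_gen : forall y G,
  spectral_integral (fun w => w%:C) E y G -> Q G = 'i%C *: y.

Let QB x y : Q (x - y) = Q x - Q y.
Proof. by rewrite addrC -scaleN1r Q_lin scaleN1r addrC. Qed.

Variables (z : X) (Y : R -> X).
Hypothesis HY : forall t a b, a <= b ->
  is_spint E (wave t) a b z (incr E a b (Y t)).

(** Extends [spint_tail] to the whole line. The right-hand side is free of [t], so one truncation
    serves all times. *)
Lemma flow_tail t a b : a <= b ->
  rnorm (Y t - incr E a b (Y t)) <= rnorm (z - incr E a b z).
Proof.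
move=> ab; apply: (@ler_addgt0_scaled _ _ _ 2) => e e0.
have [N N0 HN] := incr_cvg (Y t) e0.
have N1 : - N <= N by lra.
set Yn := incr E (- N) N (Y t).
have h1 := HN _ _ (lexx _) (lexx _).
have h2 := spint_tail dot_norm E_adj E_min (@wave_le1 _ t) ab N1 (HY t N1).
rewrite -/Yn in h1 h2.
have h3 := rnorm_incr_le dot_norm E_adj E_min (Y t - Yn) ab.
rewrite -[Y t - _](subrK (Yn - incr E a b Yn)) subrACA -incrB.
rewrite (le_trans (rnormD _ _))//.
have := rnormB (Y t - Yn) (incr E a b (Y t - Yn)); lra.
Qed.

Lemma flow_unif_continuous e : 0 < e -> exists2 d, 0 < d &
  forall s t, `|s - t| < d -> rnorm (Y s - Y t) <= e.
Proof.
(* Two tails take e / 4 each; the Lipschitz bound on the truncated part takes the other e / 2. *)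
move=> e0; have e4 : 0 < e / 4 by rewrite divr_gt0.
have [N N0 /(_ (- N) N (lexx _) (lexx _)) h] := incr_cvg z e4.
have N1 : - N <= N by lra.
pose K := 2 * (`|- N| + `|N|) * rnorm z.
have K0 : 0 <= K by rewrite !mulr_ge0// ?addr_ge0// rnorm_ge0.
exists (e / 2 / (K + 1)); first by rewrite !divr_gt0// ltr_wpDl.
move=> s t; rewrite ltr_pdivlMr ?ltr_wpDl// => st.
have hs := flow_tail s N1; have ht := flow_tail t N1.
have := spint_wave_lipschitz dot_norm E_adj E_min N1 (HY s N1) (HY t N1).
rewrite (_ : _ * `|s - t| * _ = K * `|s - t|); last by rewrite /K; ring.
have : K * `|s - t| <= `|s - t| * (K + 1) by rewrite mulrDr mulr1 mulrC lerDl.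
set Ys := incr E _ _ (Y s) in hs *; set Yt := incr E _ _ (Y t) in ht *.
have := rdistD Ys (Y s) (Y t); have := rdistD Yt Ys (Y t).
have := rdistC Yt (Y t); lra.
Qed.

Lemma flow_primitive : primitive (Q \o Y) Y.
Proof.
apply: primitive_limit => e e0.
(* One cut-off at [e / (M + 1)] makes both the truncation error of [Y] and its image by [Q] at most
   [e]. *)
have M1 : 0 < M + 1 by rewrite ltr_wpDl.
have [N N0 /(_ (- N) N (lexx _) (lexx _)) h] := incr_cvg z (divr_gt0 e0 M1).
have N1 : - N <= N by lra.
pose Y' t := incr E (- N) N (Y t).
have YY' t : rnorm (Y t - Y' t) <= e / (M + 1).
  by rewrite (le_trans (flow_tail t N1))// ltW.
exists (Q \o Y'), Y'; split.
- apply: (@primitive_quadratic _ _ _ _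
    (M * (2 * (`|- N| + `|N|) ^+ 2 * rnorm z))) => s t.
  have [G HG] := ex_spint dot_norm E_adj E_min (Y' t) (coordC_lipschitz R) N1.
  have := spint_wave_derivative dot_norm E_adj E_min N1 (HY s N1) (HY t N1) HG.
  have Y'id : incr E (- N) N (Y' t) = Y' t by rewrite /Y' incr_sub.
  have QG := Q_gen (spectral_integral_coord N1 Y'id HG).
  move=> /(ler_wpM2l M_ge0)/(le_trans (Q_le _)).
  (* Since Q G = i Y' t, the term (s - t) i Q G equals -(s - t) Y' t: the derivative formula becomes
     that of [Q \o Y']. *)
  rewrite addrC Q_lin QB QG scalerA -mulrA -expr2 sqr_i mulrN1 scaleNr addrC.
  move=> /le_trans; apply.
  by rewrite le_eqVlt; apply/orP; left; apply/eqP; ring.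
- move=> s; rewrite /= -QB (le_trans (Q_le _))//.
  rewrite (le_trans (ler_wpM2l M_ge0 (YY' s)))// mulrA ler_pdivrMr//.
  by rewrite mulrC ler_pM2l// lerDl.
- move=> s; rewrite (le_trans (YY' s))// ler_pdivrMr// ler_peMr ?(ltW e0)//.
  by rewrite lerDr.
Qed.

End Generator.

Lemma flow0 z (Y : R -> X) :
  (forall t a b, a <= b -> is_spint E (wave t) a b z (incr E a b (Y t))) ->
  Y 0 = z.
Proof.
move=> HY; apply/eqP; rewrite -subr_eq0; apply/eqP; apply: incr_dense => a b ab.
rewrite incrB; apply/eqP; rewrite subr_eq0; apply/eqP.
apply: (spint_uniq dot_norm E_adj E_min (wave_lipschitz 0) ab (HY 0 a b ab)).
(* At time 0 the wave is 1, and every sum telescopes exactly. *)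
exists 0 => n p xi d d0 [p0 pn _ _]; rewrite mul0r /ssum.
under eq_bigr do rewrite /= /wave mulr0 oppr0 expi0 scale1r.
by rewrite incr_sum p0 pn subrr rnorm0.
Qed.

End SpectralFlow.

(** * The operators of the equation *)

Section Operators.
Variables (R : realType) (X : completeNormedModType R[i]).

Lemma domB (T : operator X) x y : dom T x -> dom T y -> dom T (x - y).
Proof. by move=> Tx Ty; rewrite addrC -scaleN1r; exact: dom_linear. Qed.

Lemma opfunB (T : operator X) x y : dom T x -> dom T y -> T (x - y) = T x - T y.
Proof.
by move=> Tx Ty; rewrite addrC -scaleN1r opfun_linear// scaleN1r addrC.
Qed.

Lemma opfunZ (T : operator X) (c : R[i]) x : dom T x -> T (c *: x) = c *: T x.
Proof.
by move=> Tx; rewrite -[c *: x]addr0 opfun_linear ?opfun0 ?addr0//; exact: dom0.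
Qed.

Lemma dom_opfun_sum (T : operator X) n (c : 'I_n -> R[i]) (F : 'I_n -> X) :
  (forall k, dom T (F k)) ->
  dom T (\sum_(k < n) c k *: F k) /\
  T (\sum_(k < n) c k *: F k) = \sum_(k < n) c k *: T (F k).
Proof.
move=> TF; elim: n c F TF => [|n IH] c F TF.
  by rewrite !big_ord0 opfun0; split => //; exact: dom0.
rewrite !big_ord_recl.
have [d e] := IH (fun k => c (lift ord0 k)) (fun k => F (lift ord0 k))
  (fun k => TF _).
by rewrite opfun_linear// e; split => //; exact: dom_linear.
Qed.

(** [T] carries the graph-type norm [vnorm T] to the norm of [X] and commutes with finite sums. *)
Lemma V_tagged_limit (T : operator X) (x : R -> X) (a b : R) I :
  dom T I -> (forall t, dom T (x t)) ->
  tagged_limit (vnorm T) (fun xi u v => (v - u)%:C *: x xi) a b I <->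
  rlimit (T \o x) a b (T I).
Proof.
move=> TI Tx.
have E s xi :
    vnorm T (I - tagged_sum (fun xi u v => (v - u)%:C *: x xi) a s xi) =
    `|T I - tagged_sum (riemann_cell (T \o x)) a s xi|.
  have [d e] := @dom_opfun_sum T (size s)
    (fun k => (s`_k - (a :: s)`_k)%:C) (fun k => x (xi k)) (fun k => Tx _).
  by rewrite /vnorm opfunB// e.
by split=> H e e0; have [d d0 dP] := H e e0; exists d => // s xi ps Hs;
  have := dP s xi ps Hs; rewrite E.
Qed.

Lemma op_invP (T : operator X) y :
  (exists x, dom T x /\ T x = y) -> dom T (op_inv T y) /\ T (op_inv T y) = y.
Proof.
move=> [x Tx]; apply: (@xgetPex _ 0 [set x | dom T x /\ T x = y]).
by exists x.
Qed.

Lemma resolvent0_bijective (T : operator X) : resolvent_set T 0 ->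
  [/\ forall y, exists x, dom T x /\ T x = y,
      forall x, dom T x -> T x = 0 -> x = 0
    & exists M : R, forall x, dom T x -> rnorm x <= M * rnorm (T x)].
Proof.
move=> [H [M HM]].
have HM' x : dom T x -> rnorm x <= M * rnorm (T x).
  by move=> /HM; rewrite scale0r subr0 !rnormE -rmorphM lecR.
split; last by exists M.
- by move=> y; have [x [[Tx <-] _]] := H y; exists x; rewrite scale0r subr0.
- move=> x Tx x0; apply: rnorm_eq0; apply/eqP; rewrite eq_le rnorm_ge0 andbT.
  by rewrite (le_trans (HM' _ Tx))// x0 rnorm0 mulr0.
Qed.

End Operators.

(** * The inverse of Lambda and the operator Q *)

Section SquareRoot.
Variables (R : realType) (X : completeNormedModType R[i]).
Variable dot : {dot X for conjC}.
Hypothesis dot_norm : forall x : X, `|x| ^+ 2 = dot x x.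
Variables (B L : operator X) (J : {linear X -> X}).
Hypothesis J_bounded : bounded_operator J.
Hypothesis J_adj : bounded_adjoint dot J (fun x => - J x).
Hypothesis J_sq : forall x, J (J x) = - x.
Hypothesis B_res : resolvent_set B 0.
Hypothesis L_sqrt : positive_sqrt dot B L.

Let Li := op_inv L.

Lemma dom_sqrt x : dom B x <-> dom L x /\ dom L (L x).
Proof. by have [_ _ [<- _]] := L_sqrt. Qed.

Lemma sqrtK x : dom B x -> L (L x) = B x.
Proof. by have [_ _ [_ /(_ x)]] := L_sqrt. Qed.

Lemma sqrt_inj x : dom L x -> L x = 0 -> x = 0.
Proof.
move=> Lx x0; have [_ inj _] := resolvent0_bijective B_res.
have Bx : dom B x by apply/dom_sqrt; rewrite x0; split => //; exact: dom0.
by apply: inj => //; rewrite -sqrtK// x0 opfun0.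
Qed.

Lemma sqrt_invP y : dom L (Li y) /\ L (Li y) = y.
Proof.
apply: op_invP; have [ex _ _] := resolvent0_bijective B_res.
by have [x [/[dup] /dom_sqrt[_ Lx] /sqrtK <- <-]] := ex y; exists (L x).
Qed.

Lemma dom_sqrt_inv y : dom L (Li y). Proof. by have [] := sqrt_invP y. Qed.

Lemma sqrt_invK y : L (Li y) = y. Proof. by have [] := sqrt_invP y. Qed.

Lemma sqrt_eq x y : dom L x -> dom L y -> L x = L y -> x = y.
Proof.
move=> Lx Ly xy; apply/eqP; rewrite -subr_eq0; apply/eqP/sqrt_inj.
  exact: domB.
by rewrite opfunB// xy subrr.
Qed.

Lemma sqrtKinv x : dom L x -> Li (L x) = x.
Proof.
by move=> Lx; apply: sqrt_eq => //; [exact: dom_sqrt_inv|rewrite sqrt_invK].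
Qed.

Lemma sqrt_inv_linear (c : R[i]) x y : Li (c *: x + y) = c *: Li x + Li y.
Proof.
apply: sqrt_eq; first exact: dom_sqrt_inv.
  by apply: dom_linear; exact: dom_sqrt_inv.
by rewrite opfun_linear ?sqrt_invK//; exact: dom_sqrt_inv.
Qed.

Lemma sqrt_invN x : Li (- x) = - Li x.
Proof.
have := sqrt_inv_linear (-1) x x; rewrite !scaleN1r !addNr => L0.
by have := sqrt_inv_linear (-1) x 0; rewrite L0 !addr0 !scaleN1r.
Qed.

Lemma sqrt_inv_sym x y : dot (Li x) y = dot x (Li y).
Proof.
have [[_ saL] _ _] := L_sqrt.
have : adjoint_graph dot L (Li y, L (Li y)).
  by rewrite -saL; split => //=; exact: dom_sqrt_inv.
move=> /(_ (Li x) (dom_sqrt_inv _)) /=.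
by rewrite !sqrt_invK.
Qed.

(** By symmetry |Li y|^2 = <y, B^{-1} y> <= M |y|^2; the constant [|M| + 1] avoids the square root
    of [M]. *)
Lemma sqrt_inv_bounded : exists2 M : R, 0 <= M &
  forall y, rnorm (Li y) <= M * rnorm y.
Proof.
have [_ _ [M HM]] := resolvent0_bijective B_res.
exists (`|M| + 1) => [|y]; first by rewrite addr_ge0.
have M1 : 0 <= `|M| + 1 by rewrite addr_ge0.
rewrite -(@ler_pXn2r _ 2)// ?nnegrE ?mulr_ge0 ?rnorm_ge0//.
rewrite (rnorm_sqr dot_norm) /rdot sqrt_inv_sym -/(rdot _ _ _).
rewrite (le_trans (rdot_le dot_norm _ _))// exprMn.
have By : dom B (Li (Li y)).
  by apply/dom_sqrt; rewrite sqrt_invK; split; exact: dom_sqrt_inv.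
have := HM _ By; rewrite -sqrtK// !sqrt_invK => h.
rewrite (le_trans (ler_wpM2l (rnorm_ge0 _) h))// mulrCA -expr2.
rewrite ler_wpM2r ?sqr_ge0// (le_trans (ler_norm _))// expr2.
by rewrite (le_trans (_ : _ <= `|M| + 1)) ?lerDl// ler_peMr// lerDr.
Qed.

(* The bounded skew operator $\Lambda A^{-1}\Lambda^{-1} = i H^{-1}$. *)
Definition skew_inv (x : X) : X := - Li (J (Li x)).

Lemma skew_inv_linear (c : R[i]) x y :
  skew_inv (c *: x + y) = c *: skew_inv x + skew_inv y.
Proof.
by rewrite /skew_inv sqrt_inv_linear linearP sqrt_inv_linear opprD scalerN.
Qed.

Lemma skew_invB x y : skew_inv (x - y) = skew_inv x - skew_inv y.
Proof. by rewrite addrC -scaleN1r skew_inv_linear scaleN1r addrC. Qed.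

Lemma skew_inv_bounded : exists2 M : R, 0 <= M &
  forall x, rnorm (skew_inv x) <= M * rnorm x.
Proof.
have [M M0 HM] := sqrt_inv_bounded; have [N HN] := J_bounded.
have HN' x : rnorm (J x) <= `|N| * rnorm x.
  have := HN x; rewrite !rnormE -rmorphM lecR => /le_trans; apply.
  by rewrite ler_wpM2r ?rnorm_ge0// ler_norm.
exists (M * (`|N| * M)) => [|x]; first by rewrite !mulr_ge0.
rewrite rnormN (le_trans (HM _))// -!mulrA ler_wpM2l//.
by rewrite (le_trans (HN' _))// ler_wpM2l.
Qed.

(** By symmetry of [Li] it reduces to Re <J u, u> = 0 for u = Li x, which is skewness of [J]. *)
Lemma skew_inv_skew x : rdot dot (skew_inv x) x = 0.
Proof.
rewrite rdotNl /rdot sqrt_inv_sym -/(rdot _ _ _).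
have : rdot dot (J (Li x)) (Li x) = - rdot dot (J (Li x)) (Li x).
  by rewrite {1}/rdot J_adj -/(rdot _ _ _) rdotC rdotNl.
lra.
Qed.

Lemma skew_inv_inj x : skew_inv x = 0 -> x = 0.
Proof.
move=> /eqP; rewrite oppr_eq0 => /eqP h.
have Jx : J (Li x) = 0 by rewrite -[J _]sqrt_invK h opfun0.
have Lx : Li x = 0.
  by apply/eqP; rewrite -oppr_eq0 -J_sq Jx linear0.
by rewrite -[x]sqrt_invK Lx opfun0.
Qed.

(** [Li] cancels the outer and then the inner [L] of [op_LiJL L J], while [J] squared gives -1: this
    is Q H = i on the domain of H. *)
Lemma skew_inv_LiJL y G : dom (op_LiJL L J) y -> op_LiJL L J y = G ->
  skew_inv G = 'i%C *: y.
Proof.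
move=> [Ly LJy] <- /=; rewrite /skew_inv sqrtKinv; last exact: domZ.
rewrite linearZ J_sq/= scalerN -scaleNr -opfunZ// sqrtKinv; last exact: domZ.
by rewrite scaleNr opprK.
Qed.

Lemma inv_JBP y : let x := op_inv (op_lmul J B) y in
  dom L x /\ L x = - Li (J y).
Proof.
have ex : exists x, dom (op_lmul J B) x /\ op_lmul J B x = y.
  (* This is -B^{-1} J y, the value of A^{-1} at y. *)
  exists (Li (Li (- J y))); have Bx : dom B (Li (Li (- J y))).
    by apply/dom_sqrt; rewrite sqrt_invK; split; exact: dom_sqrt_inv.
  by split => //=; rewrite -sqrtK// !sqrt_invK linearN J_sq opprK.
have [/= Bx JBx] := op_invP ex; have [Lx LLx] := (dom_sqrt _).1 Bx.
split => //; rewrite -[L _]sqrtKinv// sqrtK// -sqrt_invN.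
by rewrite -[in RHS]JBx J_sq opprK.
Qed.

End SquareRoot.

Lemma primitive_rlimit (R : realType) (X : completeNormedModType R[i])
    (P Z : R -> X) (a b : R) : primitive P Z -> a <= b ->
  (forall e, 0 < e -> exists2 d, 0 < d &
     forall s t, `|s - t| < d -> rnorm (Z s - Z t) <= e) ->
  rlimit Z a b (P b - P a).
Proof.
move=> PZ ab Zc e e0; have [d d0 dP] := primitive_sum PZ ab Zc e0.
exists d => // s xi ps H; rewrite rnormE ltcR (tagged_sumE _ _ b).
exact: dP (itv_partition_tagged ps H).
Qed.

(** * The equation transported by Lambda *)

Section Solutions.
Variables (R : realType) (X : completeNormedModType R[i]).
Variable dot : {dot X for conjC}.
Hypothesis dot_norm : forall x : X, `|x| ^+ 2 = dot x x.
Variables (B L : operator X) (J : {linear X -> X}).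
Hypothesis J_adj : bounded_adjoint dot J (fun x => - J x).
Hypothesis J_sq : forall x, J (J x) = - x.
Hypothesis B_res : resolvent_set B 0.
Hypothesis L_sqrt : positive_sqrt dot B L.

Let Q := skew_inv L J.

Lemma sqrt_inv_JB x y : dom L x -> dom L y ->
  L (op_inv (op_lmul J B) (x - y)) = Q (L x) - Q (L y).
Proof.
move=> Lx Ly; have [_ ->] := inv_JBP J_sq B_res L_sqrt (x - y).
rewrite -(skew_invB _ B_res L_sqrt) -opfunB// /skew_inv.
by rewrite (sqrtKinv B_res L_sqrt)//; exact: domB.
Qed.

Lemma is_solutionP (x : R -> X) : is_solution L (op_lmul J B) x <->
  continuous_in_V L x /\ forall t, let W := Q (L (x t)) - Q (L (x 0)) in
    if 0 <= t then rlimit (L \o x) 0 t W else rlimit (L \o x) t 0 (- W).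
Proof.
rewrite /is_solution; split=> -[xC H]; split => // t; have [Lx _] := xC.
- have [+ HI] := H t; move: HI.
  set I := op_inv _ _ => + LI; rewrite -sqrt_inv_JB// -/I.
  case: ifP => _; first by move/V_tagged_limit; apply.
  have -> : - L I = L (- I) by rewrite -scaleN1r -opfunZ// scaleN1r.
  by move/V_tagged_limit; apply => //; rewrite -scaleN1r; exact: domZ.
- have [LI _] := inv_JBP J_sq B_res L_sqrt (x t - x 0).
  split => //; move: (H t); rewrite -sqrt_inv_JB//.
  case: ifP => _ K; first by apply/V_tagged_limit.
  apply/V_tagged_limit => //; first by rewrite -scaleN1r; exact: domZ.
  by rewrite -scaleN1r opfunZ// scaleN1r.
Qed.

Lemma solution_derivative (x : R -> X) : is_solution L (op_lmul J B) x ->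
  forall t e, 0 < e -> exists2 d, 0 < d & forall s, `|s - t| < d ->
    rnorm (Q (L (x s)) - Q (L (x t)) - (s - t)%:C *: L (x t)) <= e * `|s - t|.
Proof.
move=> /is_solutionP[[Lx xC] /rlimit_primitive xW] t e e0.
have [r d e1|d d0 dP] := @primitive_derivative _ _ _ _ xW _ t e e0.
  have [d0 /= d00 dP] := xC r d e1; exists d0 => // s sr.
  have := dP s; rewrite /= distrC => /(_ sr).
  rewrite /vnorm rnormE ltcR opfunB//.
  exact: ltW.
by exists d => // s /dP; rewrite subrACA subrr subr0.
Qed.

Lemma solution_unique (x y : R -> X) : is_solution L (op_lmul J B) x ->
  is_solution L (op_lmul J B) y -> x 0 = y 0 -> x = y.
Proof.
move=> xs ys xy0; apply/funext => t.
have [[Lx _] _] := xs; have [[Ly _] _] := ys.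
apply: (sqrt_eq B_res L_sqrt) => //.
apply/eqP; rewrite -subr_eq0; apply/eqP.
have QB := skew_invB J B_res L_sqrt.
have Q0 := skew_inv_skew J_adj B_res L_sqrt.
have Qi := skew_inv_inj J_sq B_res L_sqrt.
apply: (skew_flow_eq0 dot_norm Q0 Qi
  (D := fun t => L (x t) - L (y t))); last first.
  by rewrite xy0 subrr -[0 in LHS](subrr 0) QB subrr.
move=> {}t e e0; have e2 : 0 < e / 2 by rewrite divr_gt0.
have [d1 d10 h1] := solution_derivative xs t e2.
have [d2 d20 h2] := solution_derivative ys t e2.
exists (Num.min d1 d2); first by rewrite lt_min d10.
move=> s; rewrite lt_min => /andP[/h1 {}h1 /h2 {}h2].
rewrite !QB (subrACA (skew_inv L J (L (x s)))) scalerBr.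
rewrite (subrACA (_ - _) (_ - _) (_ *: _)) (le_trans (rnormB _ _))//.
by apply: (le_trans (lerD h1 h2)); rewrite -mulrDl -splitr.
Qed.

End Solutions.

Theorem proposition2p4 (R : realType) (X : completeNormedModType R[i])
    (dot : {dot X for conjC})
    (dot_norm : forall x : X, `|x| ^+ 2 = dot x x)
    (B : operator X) (B_sa : selfadjoint dot B)
    (J : {linear X -> X}) (J_bounded : bounded_operator J)
    (J_adj : bounded_adjoint dot J (fun x => - J x))
    (J_sq : forall x, J (J x) = - x)
    (delta : R) (delta_gt0 : 0 < delta)
    (B_spec : spectrum B `<=` [set x%:C | x in `[delta, +oo[ ])
    (L : operator X) (L_sqrt : positive_sqrt dot B L)
    (E : R -> {linear X -> X})
    (E_res : spectral_resolution dot (op_LiJL L J) E)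
    (X0 : X) (X0_V : dom L X0) :
  exists x : R -> X,
    unique (fun y => is_solution L (op_lmul J B) y /\ y 0 = X0) x /\
    forall t : R, exists2 Y : X,
      spectral_integral (fun w => expi (- (w * t))) E (L X0) Y &
      x t = op_inv L Y.
Proof.
(* The spectral gap enters here: 0 lies below [delta], which gives B and Lambda bounded inverses. *)
have B_res : resolvent_set B 0.
  apply: contrapT => /B_spec[w /=]; rewrite in_itv/= andbT => dw [w0].
  by move: dw; rewrite w0 leNgt delta_gt0.
have [E_adj E_min _ E_lim E_int] := E_res.
have [Y HY] := ex_flow dot_norm E_adj E_min E_lim (L X0).
have [M M0 HM] := skew_inv_bounded dot_norm J_bounded B_res L_sqrt.
(* The last clause of [spectral_resolution] places [y] in the domain of H with H y = G. *)
have Q_gen y G : spectral_integral (fun w => w%:C) E y G ->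
    skew_inv L J G = 'i%C *: y.
  by move=> /E_int[]; exact: (skew_inv_LiJL J_sq B_res L_sqrt).
have Y_cont := flow_unif_continuous dot_norm E_adj E_min E_lim HY.
have Y_prim := flow_primitive dot_norm E_adj E_min E_lim
  (skew_inv_linear J B_res L_sqrt) M0 HM Q_gen HY.
have Y0 := flow0 dot_norm E_adj E_min E_lim HY.
have LY t := sqrt_invK B_res L_sqrt (Y t).
have domY t := dom_sqrt_inv B_res L_sqrt (Y t).
exists (fun t => op_inv L (Y t)); split; last first.
  move=> t; exists (Y t) => //.
  by apply: (spectral_integral_incr E_lim) => a b; exact: (HY t).
have x_sol : is_solution L (op_lmul J B) (fun t => op_inv L (Y t)).
  apply/(is_solutionP J_sq B_res L_sqrt); split.
    split=> // t e e0; have e2 : 0 < e / 2 by rewrite divr_gt0.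
    have [d d0 dP] := Y_cont _ e2; exists d => //= s ts.
    rewrite /vnorm rnormE ltcR opfunB// !LY.
    have st : `|s - t| < d by rewrite distrC.
    by have := dP _ _ st; lra.
  have -> : L \o (fun t => op_inv L (Y t)) = Y by apply/funext => t /=.
  move=> t; rewrite /= !LY; case: ifP => t0.
    exact: (primitive_rlimit Y_prim).
  rewrite opprB; apply: (primitive_rlimit Y_prim) => //.
  by rewrite ltW// ltNge t0.
have x0 : op_inv L (Y 0) = X0 by rewrite Y0 (sqrtKinv B_res L_sqrt).
split=> // y [y_sol y0].
apply: (solution_unique dot_norm J_adj J_sq B_res L_sqrt) => //.
by rewrite x0 y0.
Qed.
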